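(* Let $\Sigma=\{z\in\mathbb{C}:|z|=1\}$ be the positively oriented unit circle, let $\mathcal{D}$ be a finite subset of $\Sigma$, and let $\Omega$ be a neighborhood of $\Sigma$. Let $f$ be a non-trivial (not identically zero) analytic function on $\Omega$ with $f(z)\ge 0$ for all $z\in\Sigma$. Let $\gamma$ be an analytic function on $\Omega$ which vanishes exactly on $\mathcal{D}$ and all of whose zeros are simple. Let $p_k(z)=\kappa_k z^k+\cdots$ be the orthonormal polynomials with respect to the measure $f(z)\frac{dz}{2\pi i z}$ on $\Sigma$, and let $p_k^*(z)=z^k\,\overline{p_k(\bar z^{-1})}$. Then $$\mathbf{T}_n(f,\mathcal{D})=\mathcal{T}_n(f)\,\det(1+K)_{L^2(\Sigma_{in}\cup\Sigma_{out},\,\frac{dz}{2\pi i z})},$$ where $K$ is the integral operator with kernel $$K(z,w)=K_{conti}(z,w)\sqrt{v(z)v(w)f(z)f(w)},\qquad K_{conti}(z,w)=z^{-n}\,\frac{p_n(z)p_n^*(w)-p_n^*(z)p_n(w)}{1-z^{-1}w}.$$ Here $\Sigma_{in}$ and $\Sigma_{out}$ are the positively oriented circles centered at $0$ of radii $1-\epsilon$ and $1+\epsilon$, respectively, for a small $\epsilon>0$, and $$v(z)=\begin{cases}-\dfrac{z\gamma'(z)}{|\mathcal{D}|\gamma(z)}, & z\in\Sigma_{in},\\[2mm] \dfrac{z\gamma'(z)}{|\mathcal{D}|\gamma(z)}-1, & z\in\Sigma_{out}.\end{cases}$$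
   Context: The discrete Toeplitz determinant is $\mathbf{T}_n(f,\mathcal{D})=\det\Big[\frac1{|\mathcal{D}|}\sum_{z\in\mathcal{D}}z^{-j+k}f(z)\Big]_{j,k=0}^{n-1}$ and the continuous Toeplitz determinant is $\mathcal{T}_n(f)=\det\Big[\int_{|z|=1}z^{-j+k}f(z)\frac{dz}{2\pi i z}\Big]_{j,k=0}^{n-1}$. Orthonormality means $\int_{|z|=1}\overline{p_j(z)}p_k(z)f(z)\frac{dz}{2\pi i z}=\delta_{jk}$, with leading coefficients $\kappa_k>0$. The determinant $\det(1+K)$ is the Fredholm determinant with respect to the complex measure $\frac{dz}{2\pi i z}$ on $\Sigma_{in}\cup\Sigma_{out}$. The factor $\sqrt{v(z)v(w)f(z)f(w)}$ is read as $g(z)g(w)$, where $g$ is a fixed choice of square root of $v f$ on $\Sigma_{in}\cup\Sigma_{out}$. *)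

(* Defs.v *)
From HB Require Import structures.
From mathcomp Require Import all_boot all_order all_algebra finmap.
From mathcomp Require Import complex.
From mathcomp Require Import all_classical all_reals all_analysis.

Set Implicit Arguments.
Unset Strict Implicit.
Unset Printing Implicit Defensive.

Import Order.TTheory GRing.Theory Num.Theory.
Import numFieldNormedType.Exports.

Local Open Scope classical_set_scope.
Local Open Scope ring_scope.

(* Packing R[i] as a structure gives it the canonical normed topology that
   numFieldNormedType puts on every numClosedFieldType; the bare type R[i]
   has no topological instance. *)
Definition cplx (R : realType) : numClosedFieldType := R[i].

Section Circles.
Variable R : realType.
Implicit Types (r t : R) (z a : cplx R) (F h : cplx R -> cplx R).

Definition circle r : set (cplx R) := [set z | `|z| = (r%:C)%C].

Definition circle_point r t : cplx R := (r * cos t +i* (r * sin t))%C.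

Definition int02pi (h : R -> cplx R) : cplx R :=
  ((\int[lebesgue_measure]_(t in `[0, 2 * pi]) complex.Re (h t)) +i*
   (\int[lebesgue_measure]_(t in `[0, 2 * pi]) complex.Im (h t)))%C.

(* The contour integral of F over the positively oriented circle |z| = r, with
   the parametrization z = r e^(it), dz = i z dt. *)
Definition contour_int r F : cplx R :=
  int02pi (fun t => F (circle_point r t) * ('i * circle_point r t)).

(* Integration over |z| = r against dz / (2 pi i z). *)
Definition circle_int r h : cplx R :=
  contour_int r (fun z => h z / (2 * (pi%:C)%C * 'i * z)).

Definition analytic_at F a : Prop :=
  exists c : nat -> cplx R,
    \forall z \near a, [series c k * (z - a) ^+ k]_k @ \oo --> F z.

Definition analytic_on (Omega : set (cplx R)) F : Prop :=
  forall a, Omega a -> analytic_at F a.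

End Circles.

Section Fredholm.
Variable T : Type.
Variable K : numFieldType.
Variable int : (T -> K) -> K.

Fixpoint iter_int (m : nat) : (m.-tuple T -> K) -> K :=
  match m with
  | 0 => fun F => F [tuple]
  | m'.+1 => fun F => int (fun x => iter_int (fun s => F [tuple of x :: s]))
  end.

(* The term of order m of the Fredholm expansion of det(1 + k), for the
   integral operator with kernel k against the measure whose integration
   functional is int. *)
Definition fredholm_term (k : T -> T -> K) (m : nat) : K :=
  m`!%:R^-1 *
  iter_int (fun s : m.-tuple T =>
    \det (\matrix_(i < m, j < m) k (tnth s i) (tnth s j))).

Definition fredholm_det (k : T -> T -> K) : K :=
  limn (series (fredholm_term k)).

End Fredholm.

Section Toeplitz.
Variable R : realType.
Local Notation C := (cplx R).
Implicit Types (f gamma g : C -> C) (D : {fset C}) (p : nat -> {poly C}).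
Implicit Types (n : nat) (z w : C) (eps : R).

Definition discrete_toeplitz n f D : C :=
  \det (\matrix_(j < n, k < n)
    (#|` D|%:R^-1 * \sum_(z <- D) z ^ (k%:Z - j%:Z) * f z)).

Definition continuous_toeplitz n f : C :=
  \det (\matrix_(j < n, k < n)
    circle_int 1 (fun z => z ^ (k%:Z - j%:Z) * f z)).

Definition orthonormal_polys f p : Prop :=
  [/\ forall k, size (p k) = k.+1,
      forall k, 0 < lead_coef (p k)
    & forall j k,
        circle_int 1 (fun z => ((p j).[z])^* * (p k).[z] * f z) = (j == k)%:R].

Definition pstar p k z : C := z ^+ k * ((p k).[(z^*)^-1])^*.

Definition Kquot p n z w : C :=
  z ^- n * (((p n).[z] * pstar p n w - pstar p n z * (p n).[w])
            / (1 - z^-1 * w)).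

(* On the diagonal the quotient is 0 / 0; K_conti is its continuous extension
   there, the singularity being removable. *)
Definition Kconti p n z w : C :=
  if w == z then lim (Kquot p n z w' @[w' --> z^']) else Kquot p n z w.

(* Only used on the circles of radii 1 - eps and 1 + eps, 0 < eps < 1. *)
Definition vfun D gamma z : C :=
  let q := z * derive1 gamma z / (#|` D|%:R * gamma z) in
  if `|z| < 1 then - q else q - 1.

(* g stands for the chosen square root of v f. *)
Definition Kkernel p n g z w : C := Kconti p n z w * (g z * g w).

Definition in_out_int eps (h : C -> C) : C :=
  circle_int (1 - eps) h + circle_int (1 + eps) h.

End Toeplitz.

(* Main.v *)
Require Import Defs.
From HB Require Import structures.
From mathcomp Require Import all_boot all_order all_algebra finmap perm.
From mathcomp Require Import complex.
From mathcomp Require Import all_classical all_reals all_analysis.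
From mathcomp Require Import ring lra.

(** For w != z the Christoffel-Darboux formula turns K_conti(z, w) into the sum
    over k < n of a_k(z) p_k(w), where a_k(z) is the conjugate of p_k(1/conj z);
    by continuity this also holds on the diagonal.  So K has rank n and
    det (1 + K) = det (1 + M), where M_kl is the integral of
    h_kl v = a_k p_l f v over both circles.  On the outer circle v contains
    the summand -1; since h_kl is holomorphic near the unit circle, that part
    contributes -delta_kl by orthonormality.  What remains is the difference of
    the integrals of h_kl z gamma'/(|D| gamma) over the two circles, which by the
    residue theorem is the mean of h_kl over D.  Hence 1 + M is the Gram matrix
    of the p_k for the discrete measure, and the change of basis from the
    monomials to the p_k multiplies both Toeplitz determinants by the same
    factor; for the continuous measure the Gram matrix is the identity. *)

Set Implicit Arguments.
Unset Strict Implicit.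
Unset Printing Implicit Defensive.

Import Order.TTheory GRing.Theory Num.Theory.
Import numFieldNormedType.Exports.

Local Open Scope classical_set_scope.
Local Open Scope ring_scope.

(** * Principal minors and finite-rank Fredholm determinants *)

(** The function [g] is an arbitrary pointwise square root, possibly neither continuous nor
    measurable, so an integral that contains a single factor [g] cannot be manipulated. The Fredholm
    terms are therefore rewritten pointwise, inside the determinants, until only [g ^+ 2], that is v
    f, is left. Linearity of the integral is then invoked only for combinations of products
    [A k * B l], which are continuous along both circles. For a kernel of rank n the partial sums of
    the Fredholm series are eventually constant, so convergence comes with the value.

    The points of D lie between the two contours, and the contour arguments all reduce to one fact:
    the circle integral of a function holomorphic off the unit circle and continuous across it does
    not depend on the radius, because its radial derivative integrates an angular derivative over a
    full period. Poles are removed by subtracting multiples of z / (z - a), whose integrals are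
    found by letting the radius tend to 0 or to infinity. The bound on eps is the half-width of an
    annulus around the unit circle inside Omega, capped at 1. *)

Section PrincipalMinors.
Variable K : numFieldType.

(** Its determinant is the principal minor of [M] on [S]. The identity rows keep the size equal to
    n, so that minors of all orders can be summed over [S] in one matrix type. *)
Definition minor_rows n (M : 'M[K]_n) (S : {set 'I_n}) : 'M[K]_n :=
  \matrix_(i, j) if i \in S then M i j else (i == j)%:R.

(** Distribute the product in each Leibniz term: [S] is the set of rows in which the entry of [M],
    rather than that of the identity, is chosen. *)
Lemma det_add1mx n (M : 'M[K]_n) :
  \det (1%:M + M) = \sum_(S : {set 'I_n}) \det (minor_rows M S).
Proof.
rewrite /determinant exchange_big /=; apply: eq_bigr => s _.
rewrite -mulr_sumr; congr (_ * _).
under eq_bigr => i _ do rewrite !mxE addrC.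
rewrite bigA_distr /=.
apply: eq_bigr => S _.
by apply: eq_bigr => i _; rewrite !mxE; case: ifP.
Qed.

(** The k remaining indices are sent to an enumeration of the complement of the image of [h]. *)
Lemma inj_ext_perm m k (h : 'I_m -> 'I_(m + k)) : injective h ->
  exists s : 'S_(m + k), forall i, s (lshift k i) = h i.
Proof.
move=> hinj.
pose A := [set h i | i : 'I_m]%SET.
have cA : #|A| = m by rewrite card_imset // card_ord.
have cB : #|~: A| = k by rewrite cardsCs finset.setCK cA card_ord addKn.
pose u (x : 'I_(m + k)) :=
  match fintype.split x with
  | inl i => h i
  | inr j => enum_val (cast_ord (esym cB) j)
  end.
have uinj : injective u.
  move=> x y; rewrite /u.
  rewrite -{2}(fintype.splitK x) -{2}(fintype.splitK y).
  case: (fintype.split x) => i; case: (fintype.split y) => j /=.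
  - by move/hinj ->.
  - move=> e; have := enum_valP (cast_ord (esym cB) j).
    by rewrite -e inE imset_f.
  - move=> e; have := enum_valP (cast_ord (esym cB) i).
    by rewrite e inE imset_f.
  - by move/enum_val_inj/cast_ord_inj ->.
exists (perm uinj) => i; rewrite permE /u.
by have -> : lshift k i = unsplit (inl i : 'I_m + 'I_k)%type by []; rewrite
  fintype.unsplitK.
Qed.

(* Listing the image of [h] first makes [minor_rows] block triangular, the
   second diagonal block being an identity. *)
Lemma det_minor_rows m n (M : 'M[K]_n) (h : 'I_m -> 'I_n) : injective h ->
  \det (\matrix_(i, j) M (h i) (h j)) =
  \det (minor_rows M [set h i | i : 'I_m]%SET).
Proof.
move=> hinj.
have [k ek] : exists k, n = (m + k)%N.
  by exists (n - m)%N; rewrite subnKC // -(card_ord m) -(card_ord n) (leq_card _ hinj).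
subst n.
have [s hs] := inj_ext_perm hinj.
set S := [set h i | i : 'I_m]%SET.
have sS x : (s x \in S) = (if fintype.split x is inl _ then true else false).
  rewrite -{1}(fintype.splitK x); case: (fintype.split x) => i /=; first by rewrite
    hs imset_f.
  apply/imsetP => -[j _]; rewrite -hs => /perm_inj /(congr1 val) /= e.
  by have := ltn_ord j; rewrite -e ltnNge leq_addr.
have <- : \det (row_perm s (col_perm s (minor_rows M S))) = \det (minor_rows M S).
  rewrite row_permE col_permE !det_mulmx !det_perm mulrC -mulrA odd_permV.
  by rewrite -signr_addb addbb mulr1.
rewrite -[row_perm s _]submxK.
have -> : dlsubmx (row_perm s (col_perm s (minor_rows M S))) = 0.
  apply/matrixP => i j; rewrite !mxE sS.
  have -> : rshift m i = unsplit (inr i : 'I_m + 'I_k)%type by [].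
  rewrite fintype.unsplitK; case: eqP => // /perm_inj /(congr1 val) /= e.
  by have := ltn_ord j; rewrite -e ltnNge leq_addr.
have -> : drsubmx (row_perm s (col_perm s (minor_rows M S))) = 1%:M.
  apply/matrixP => i j; rewrite !mxE sS.
  have -> : rshift m i = unsplit (inr i : 'I_m + 'I_k)%type by [].
  by rewrite fintype.unsplitK (inj_eq perm_inj) eq_rshift.
rewrite det_ublock det1 mulr1; congr (\det _); apply/matrixP => i j.
by rewrite !mxE !hs imset_f.
Qed.

Lemma sum_det_minors n (M : 'M[K]_n) m :
  \sum_(h : {ffun 'I_m -> 'I_n}) \det (\matrix_(i, j) M (h i) (h j)) =
  m`!%:R * \sum_(S : {set 'I_n} | #|S| == m) \det (minor_rows M S).
Proof.
rewrite (bigID (fun h : {ffun 'I_m -> 'I_n} => injectiveb h)) /=.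
rewrite [X in _ + X]big1 ?addr0; last first.
  move=> h /injectivePn [i [j ij hij]].
  apply: (determinant_alternate ij) => l; rewrite !mxE hij //.
rewrite (partition_big (fun h : {ffun _ -> _} => [set h i | i : 'I_m]%SET)
   (fun S => #|S| == m)) /=; last first.
  by move=> h /injectiveP hi; rewrite card_imset // card_ord.
rewrite mulr_sumr; apply: eq_bigr => S /eqP cS.
rewrite (eq_bigr (fun=> \det (minor_rows M S))); last first.
  by move=> h /andP[/injectiveP hi /eqP <-]; rewrite det_minor_rows.
rewrite sumr_const -[LHS]mulr_natl. congr (_%:R * _).
have -> : m`! = #|S| ^_ #|'I_m| by rewrite cS card_ord ffactnn.
rewrite -card_inj_ffuns_on.
apply: eq_card => h; rewrite !inE.
apply/andP/andP => [[hi /eqP <-]|[/ffun_onP ho hi]]; split => //.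
  by apply/ffun_onP => i; rewrite imset_f.
rewrite eqEcard; apply/andP; split.
  by apply/fintype.subsetP => x /imsetP[i _ ->]; exact: ho.
by rewrite card_imset ?card_ord ?cS //; apply/injectiveP.
Qed.

Lemma det_add1mx_series n (M : 'M[K]_n) N : (n < N)%N ->
  \sum_(0 <= m < N) (m`!%:R^-1 *
     \sum_(h : {ffun 'I_m -> 'I_n}) \det (\matrix_(i, j) M (h i) (h j))) =
  \det (1%:M + M).
Proof.
move=> nN; rewrite det_add1mx.
(* Subsets are sorted by cardinality. Truncation by [inord] is harmless because a subset has at most
   n < N elements. *)
rewrite [RHS](partition_big (fun S : {set 'I_n} => inord #|S| : 'I_N.-1.+1) xpredT) //=.
rewrite (big_mkord xpredT) -[N](@prednK N) ?(leq_ltn_trans _ nN) //.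
apply: eq_bigr => m _; rewrite sum_det_minors mulrA mulVf ?mul1r; last first.
  by rewrite pnatr_eq0 -lt0n fact_gt0.
apply: eq_bigl => S; rewrite -val_eqE /= inordK // (prednK (leq_ltn_trans _ nN)) //.
by rewrite (leq_ltn_trans _ nN) // -[X in (_ <= X)%N](card_ord n) max_card.
Qed.

End PrincipalMinors.

Section FiniteRankFredholm.
Variables (T : Type) (K : numFieldType) (int : (T -> K) -> K) (S : set T).
Variables (n : nat) (A B : 'I_n -> T -> K).

Hypothesis int_ext : forall h1 h2 : T -> K,
  (forall x, S x -> h1 x = h2 x) -> int h1 = int h2.
Hypothesis int_lin : forall (I : finType) (c : I -> K) (k l : I -> 'I_n),
  int (fun x => \sum_i c i * (A (k i) x * B (l i) x)) =
  \sum_i c i * int (fun x => A (k i) x * B (l i) x).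

(** An integral need not be additive on arbitrary functions, so linearity is available only for
    combinations of products [A k * B l]. This is enough: once the inner variables are integrated
    out, their values become coefficients and the outer integrand is again such a combination. *)
Lemma iter_int_separated m (I : finType) (c : I -> K) (k l : I -> 'I_m -> 'I_n)
    (F : m.-tuple T -> K) :
  (forall s, (forall i, S (tnth s i)) ->
     F s = \sum_u c u * \prod_i (A (k u i) (tnth s i) * B (l u i) (tnth s i))) ->
  iter_int int F =
    \sum_u c u * \prod_i int (fun x => A (k u i) x * B (l u i) x).
Proof.
elim: m => [|m IHm] in I c k l F *.
  move=> /= -> ; last by case.
  by apply: eq_bigr => u _; rewrite !big_ord0.
move=> HF /=.
have step x : S x ->
    iter_int int (fun s : m.-tuple T => F [tuple of x :: s]) =
    \sum_u (c u * \prod_(i < m) int (fun x => A (k u (lift ord0 i)) x * B (l u (lift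
      ord0 i)) x))
       * (A (k u ord0) x * B (l u ord0) x).
  move=> Sx.
  rewrite (IHm I (fun u => c u * (A (k u ord0) x * B (l u ord0) x))
     (fun u i => k u (lift ord0 i)) (fun u i => l u (lift ord0 i))).
    by apply: eq_bigr => u _; rewrite mulrAC.
  move=> s Ss; rewrite HF.
    apply: eq_bigr => u _; rewrite big_ord_recl tnth0 -[RHS]mulrA.
    by congr (_ * (_ * _)); apply: eq_bigr => i _; rewrite tnthS.
  by move=> i; case: (unliftP ord0 i) => [j ->|->]; rewrite ?tnthS ?tnth0.
rewrite (int_ext step) int_lin; apply: eq_bigr => u _.
by rewrite big_ord_recl -mulrA; congr (_ * _); rewrite mulrC.
Qed.

Let M : 'M[K]_n := \matrix_(k, l) int (fun x => A k x * B l x).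

(** The hypothesis compares determinants, not kernels, because [k] itself may contain factors that
    cancel only in the determinant. Expanding over a permutation and an index map [h] makes the
    integrand a product over the variables; integrating it turns each factor into an entry of
    [M]. *)
Lemma fredholm_term_finite_rank (k : T -> T -> K) m :
  (forall s : m.-tuple T, (forall i, S (tnth s i)) ->
     \det (\matrix_(i, j) k (tnth s i) (tnth s j)) =
     \det (\matrix_(i, j) \sum_l A l (tnth s i) * B l (tnth s j))) ->
  fredholm_term int k m = m`!%:R^-1 *
     \sum_(h : {ffun 'I_m -> 'I_n}) \det (\matrix_(i, j) M (h i) (h j)).
Proof.
move=> Hk; rewrite /fredholm_term; congr (_ * _).
rewrite (@iter_int_separated m ({perm 'I_m} * {ffun 'I_m -> 'I_n})%type
  (fun u => (-1) ^+ u.1) (fun u i => u.2 i) (fun u i => u.2 ((u.1^-1)%g i))).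
  rewrite [RHS]exchange_big pair_bigA /=.
  (* The permutation enters through its inverse, which has the same sign. *)
  rewrite [RHS](reindex (fun u : {perm 'I_m} * {ffun 'I_m -> 'I_n} => (u.1^-1%g,
    u.2))) /=; last first.
    by exists (fun u : {perm 'I_m} * {ffun 'I_m -> 'I_n} => (u.1^-1%g, u.2)) => -[u
      v] _ /=; rewrite invgK.
  apply: eq_bigr => -[s h] _ /=.
  by rewrite odd_permV; congr (_ * _); apply: eq_bigr => i _; rewrite !mxE.
move=> s Ss; rewrite Hk // /determinant.
rewrite -(pair_bigA _ (fun (p : {perm 'I_m}) (h : {ffun 'I_m -> 'I_n}) => (-1) ^+ p *
  \prod_i (A (h i) (tnth s i) * B (h ((p^-1)%g i)) (tnth s i)))) /=.
apply: eq_bigr => p _; rewrite -mulr_sumr; congr (_ * _).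
under eq_bigr => i _ do rewrite mxE.
rewrite bigA_distr_bigA /=; apply: eq_bigr => h _.
rewrite !big_split /=; congr (_ * _).
(* The factor [B] occurs at the variable of index [p i]; reindexing brings the [A] and [B] factors
   of each variable together. *)
rewrite [RHS](reindex_inj (@perm_inj _ p)) /=.
by apply: eq_bigr => i _; rewrite permK.
Qed.

(* Only [g ^+ 2] survives in the determinants, whatever the choice of root. *)
Lemma fredholm_finite_rank (k : T -> T -> K) (a : 'I_n -> T -> K) (g : T -> K) :
  (forall x y, S x -> S y -> k x y = (\sum_l a l x * B l y) * (g x * g y)) ->
  (forall l x, S x -> A l x = a l x * g x ^+ 2) ->
  series (fredholm_term int k) N @[N --> \oo] --> \det (1%:M + M).
Proof.
move=> Hk HA; apply: cvg_near_cst; exists n.+1 => // N /= nN.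
rewrite -(det_add1mx_series M nN) /series /=.
apply: eq_bigr => m _; apply: fredholm_term_finite_rank => s Ss.
pose X := \matrix_(i < m, j < m) \sum_l a l (tnth s i) * B l (tnth s j).
pose d := diag_mx (\row_(i < m) g (tnth s i)).
have -> : \matrix_(i < m, j < m) k (tnth s i) (tnth s j) = d *m X *m d.
  apply/matrixP => i j; rewrite mul_mx_diag mul_diag_mx !mxE Hk //.
  by rewrite mulrCA mulrA.
have -> : \matrix_(i < m, j < m) \sum_l A l (tnth s i) * B l (tnth s j) = d *m (d *m X).
  apply/matrixP => i j; rewrite !mul_diag_mx !mxE !mulr_sumr.
  apply: eq_bigr => l _; rewrite HA // expr2; ring.
by rewrite !det_mulmx mulrC.
Qed.

End FiniteRankFredholm.

(** * The Christoffel-Darboux formula *)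

Section ConjReverse.
Variable C : numClosedFieldType.
Implicit Types a b : {poly C}.

Definition conjp a : {poly C} := map_poly Num.conj a.

(** The reversal z^n conj(a(1 / conj z)) of a polynomial of degree at most n. The bound n is
    explicit because the operation depends on it, not on the actual degree, and is an involution
    only relative to it. *)
Definition revp n a : {poly C} := \poly_(i < n.+1) (a`_(n - i))^*.

Lemma size_revp n a : (size (revp n a) <= n.+1)%N.
Proof. exact: size_poly. Qed.

Lemma coef_revp n a i : (revp n a)`_i = if (i <= n)%N then (a`_(n - i))^* else 0.
Proof. by rewrite coef_poly ltnS. Qed.

Lemma revpK n a : (size a <= n.+1)%N -> revp n (revp n a) = a.
Proof.
move=> sa; apply/polyP => i; rewrite coef_revp; case: leqP => [le_in|lt_ni].
  by rewrite coef_revp leq_subr subKn // conjCK.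
by rewrite nth_default // (leq_trans sa).
Qed.

Lemma revpD n a b : revp n (a + b) = revp n a + revp n b.
Proof.
by apply/polyP => i; rewrite coefD !coef_revp coefD; case: leqP; rewrite ?rmorphD
  ?addr0.
Qed.

Lemma revpZ n c a : revp n (c *: a) = c^* *: revp n a.
Proof.
by apply/polyP => i; rewrite coefZ !coef_revp coefZ; case: leqP; rewrite ?rmorphM
  ?mulr0.
Qed.

Lemma revpS_mulX n a : (size a <= n.+1)%N -> revp n.+1 ('X * a) = revp n a.
Proof.
move=> sa; apply/polyP => i; rewrite !coef_revp coefXM subn_eq0.
case: (leqP i n) => [le_in|lt_ni].
  by rewrite leqW // subSn.
by rewrite rmorph0 if_same.
Qed.

Lemma revpS n a : (size a <= n.+1)%N -> revp n.+1 a = 'X * revp n a.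
Proof.
move=> sa; apply/polyP => i; rewrite coefXM !coef_revp.
case: i => [|i] /=; first by rewrite subn0 nth_default ?rmorph0.
by rewrite ltnS subSS.
Qed.

Lemma horner_conjp a x : (conjp a).[x] = (a.[x^*])^*.
Proof. by rewrite /conjp -{1}(conjCK x) horner_map. Qed.

Lemma conjpD a b : conjp (a + b) = conjp a + conjp b.
Proof. exact: rmorphD. Qed.

Lemma conjpZ c a : conjp (c *: a) = c^* *: conjp a.
Proof. exact: map_polyZ. Qed.

Lemma conjpXM a : conjp ('X * a) = 'X * conjp a.
Proof. by rewrite /conjp rmorphM /= map_polyX. Qed.

Lemma horner_revp n a x : (size a <= n.+1)%N -> x != 0 ->
  (revp n a).[x] = x ^+ n * (conjp a).[x^-1].
Proof.
move=> sa x0; rewrite horner_poly (@horner_coef_wide _ n.+1); last first.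
  by rewrite size_map_poly.
rewrite mulr_sumr [LHS](reindex_inj rev_ord_inj) /=; apply: eq_bigr => i _.
have le_in : (i <= n)%N by rewrite -ltnS.
rewrite subSS subKn // coef_map /= mulrCA; congr (_ * _).
by rewrite exprVn expfB_cond // (negPf x0) /= .
Qed.

End ConjReverse.

Section ChristoffelDarboux.
Variable C : numClosedFieldType.
Variable ip : {poly C} -> {poly C} -> C.
Implicit Types a b : {poly C}.
Hypothesis ip_linr : forall a c b1 b2, ip a (c *: b1 + b2) = c * ip a b1 + ip a b2.
Hypothesis ip_conj : forall a b, ip b a = (ip a b)^*.
Hypothesis ip_X : forall a b, ip ('X * a) ('X * b) = ip a b.
Hypothesis ip_rev : forall n a b, (size a <= n.+1)%N -> (size b <= n.+1)%N ->
  ip (revp n a) (revp n b) = ip b a.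
Variable p : nat -> {poly C}.
Hypothesis size_p : forall k, size (p k) = k.+1.
Hypothesis ortho_p : forall j k, ip (p j) (p k) = (j == k)%:R.

Let ip0 a : ip a 0 = 0.
Proof. by have := ip_linr a (-1) 0 0; rewrite scaler0 addr0 mulN1r addNr. Qed.

Let ipD a b1 b2 : ip a (b1 + b2) = ip a b1 + ip a b2.
Proof. by rewrite -[b1]scale1r ip_linr mul1r scale1r. Qed.

Let ipZ a c b : ip a (c *: b) = c * ip a b.
Proof. by rewrite -[c *: b]addr0 ip_linr ip0 addr0. Qed.

Let ip_sum a (I : finType) (F : I -> {poly C}) :
  ip a (\sum_i F i) = \sum_i ip a (F i).
Proof. by elim/big_rec2: _ => // i x y _ <-; rewrite ipD. Qed.

Let ipZl a c b : ip (c *: a) b = c^* * ip a b.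
Proof. by rewrite ip_conj ipZ rmorphM /= -ip_conj. Qed.

Let ipDl a1 a2 b : ip (a1 + a2) b = ip a1 b + ip a2 b.
Proof. by rewrite ip_conj ipD rmorphD /= -!ip_conj. Qed.

Let lead_p_neq0 k : (p k)`_k != 0.
Proof. by have := lead_coef_eq0 (p k); rewrite lead_coefE size_p /= -size_poly_eq0
  size_p => ->. Qed.

Let sub_lead_size k a : (size a <= k.+1)%N ->
  (size (a - (a`_k / (p k)`_k) *: p k)%R <= k)%N.
Proof.
move=> sa; apply/leq_sizeP => j lekj; rewrite coefB coefZ.
move: lekj; rewrite leq_eqVlt => /predU1P[<-|ltkj]; first by rewrite divfK ?subrr.
by rewrite (nth_default _ (leq_trans sa ltkj)) [(p k)`_j]nth_default ?size_p // mulr0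
  subrr.
Qed.

(** Any expansion suffices, since orthonormality then forces its coefficients. One exists by
    removing the leading coefficient degree by degree. *)
Lemma expand_ortho k a : (size a <= k)%N -> a = \sum_(j < k) ip (p j) a *: p j.
Proof.
move=> sa.
suff [c ->] : exists c : nat -> C, a = \sum_(j < k) c j *: p j.
  apply: eq_bigr => j _; rewrite ip_sum (bigD1 j) //= ipZ ortho_p eqxx mulr1.
  by rewrite big1 ?addr0 // => i /negPf; rewrite ipZ ortho_p eq_sym -val_eqE /= =>
    ->; rewrite mulr0.
elim: k a sa => [|k IHk] a sa.
  by exists (fun=> 0); rewrite big_ord0; apply/eqP; rewrite -size_poly_leq0.
have [c Hc] := IHk _ (sub_lead_size sa).
exists (fun j => if j == k then a`_k / (p k)`_k else c j).
rewrite big_ord_recr /= eqxx.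
under eq_bigr => i _ do rewrite (ltn_eqF (ltn_ord i)).
by rewrite -Hc subrK.
Qed.

Lemma ortho_small k a : (size a <= k)%N -> ip a (p k) = 0.
Proof.
move=> sa; rewrite ip_conj (expand_ortho sa) ip_sum big1 ?rmorph0 // => j _.
by rewrite ipZ ortho_p gtn_eqF ?mulr0.
Qed.

(* [p n.+1 - al z p n] has degree at most [n] and is orthogonal to z, ..., z^n,
   so its reversal is orthogonal to p_0, ..., p_(n-1), i.e. a multiple of [p n].
   The relation between [al] and [be] comes from comparing norms. *)
Lemma szego_recurrence n : exists al be : C,
  al * al^* - be * be^* = 1 /\ p n.+1 = al *: ('X * p n) + be *: revp n (p n).
Proof.
(* The quotient of leading coefficients, so that the top degree cancels in [q]. *)
pose al := (p n.+1)`_n.+1 / (p n)`_n.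
pose q := p n.+1 - al *: ('X * p n).
have sq : (size q <= n.+1)%N.
  apply/leq_sizeP => j lenj; rewrite coefB coefZ coefXM.
  move: lenj; rewrite leq_eqVlt => /predU1P[<-|ltnj] /=; first by rewrite divfK ?subrr.
  case: j ltnj => // j ltnj /=.
  by rewrite [(p n)`_j]nth_default ?size_p // [_`_j.+1]nth_default ?size_p // mulr0
    subrr.
have orth j : (j < n)%N -> ip (p j) (revp n q) = 0.
  move=> ltjn.
  have sj : (size (p j) <= n)%N by rewrite size_p.
  rewrite -[p j](@revpK _ n) ?leqW // ip_rev ?size_revp // ip_conj.
  (* Since j < n, n is a successor and the reversal of [p j] is X times a polynomial of smaller
     degree. It is orthogonal to [p n.+2] by degree, and to X times [p n.+1] after cancelling X. *)
  case: n @al @q sq ltjn sj => // n al q sq ltjn sj.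
  rewrite revpS // ipD -scaleNr ipZ ip_X (@ortho_small n.+1) ?size_revp // mulr0 addr0.
  by rewrite ortho_small ?rmorph0 // -revpS // size_revp.
have eq_rq : revp n q = ip (p n) (revp n q) *: p n.
  rewrite {1}(expand_ortho (size_revp n q)) big_ord_recr /= big1 ?add0r // => j _.
  by rewrite orth ?scale0r.
pose be := (ip (p n) (revp n q))^*.
have eq_p : p n.+1 = al *: ('X * p n) + be *: revp n (p n).
  by rewrite -revpZ -eq_rq revpK // addrC subrK.
exists al, be; split => //.
have eX : al *: ('X * p n) = p n.+1 + (- be) *: revp n (p n).
  by rewrite eq_p scaleNr addrK.
(* The cross terms vanish because the reversal of [p n] has degree at most n and is orthogonal to
   [p n.+1]. *)
have := congr1 (fun a => ip a a) eX.
rewrite ipZ ipZl ip_X ortho_p eqxx mulr1 ipD !ipDl !ipZ !ipZl ip_rev ?size_p //.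
rewrite !ortho_p !eqxx (@ortho_small n.+1) ?size_revp // ip_conj (@ortho_small n.+1)
  ?size_revp //.
rewrite rmorph0 rmorphN /= => ->; rewrite !mulr0 mulr1n; move: (be) => b; ring.
Qed.

(** Here [x] plays the role of 1/z, which keeps the identity polynomial in both variables. In the
    inductive step the recurrence turns the right-hand side into the factor al conj(al) - be
    conj(be) = 1 times the previous one plus the new summand. *)
Lemma christoffel_darboux n x z :
  (1 - x * z) * \sum_(k < n) (conjp (p k)).[x] * (p k).[z] =
  (conjp (revp n (p n))).[x] * (revp n (p n)).[z] - (conjp (p n)).[x] * (p n).[z].
Proof.
elim: n => [|n IHn].
  rewrite big_ord0 mulr0; have := size_p 0.
  have /size1_polyC -> : (size (p 0) <= 1)%N by rewrite size_p.
  move=> _; have -> (c : C) : revp 0 c%:P = (c^*)%:P.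
    by apply/polyP => i; rewrite coef_revp !coefC leqn0; case: eqP => [->|//].
  by rewrite /conjp !map_polyC /= !hornerE conjCK mulrC subrr.
rewrite big_ord_recr /= mulrDr IHn.
have [al [be [det1 ep]]] := szego_recurrence n.
have er : revp n.+1 (p n.+1) = al^* *: revp n (p n) + be^* *: ('X * p n).
  rewrite ep revpD !revpZ revpS_mulX ?size_p // revpS ?size_revp // revpK ?size_p //.
rewrite er ep !(conjpD, conjpZ, conjpXM) !conjCK !(hornerD, hornerZ, hornerM, hornerX).
set A := (conjp (revp n _)).[x]; set B := (revp n _).[z].
set P := (conjp (p n)).[x]; set Q := (p n).[z].
transitivity ((al * al^* - be * be^*) * (A * B - x * z * (P * Q))); last first.
  by rewrite /=; ring.
by rewrite det1; ring.
Qed.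

End ChristoffelDarboux.

(** * Change of basis from monomials to the orthonormal polynomials *)

Section ToeplitzBasis.
Variable C : numClosedFieldType.
Implicit Types (a b : {poly C}) (z : C).

Definition coef_mx n (p : nat -> {poly C}) : 'M[C]_n := \matrix_(k, i) (p k)`_i.

Lemma det_change_basis n (p : nat -> {poly C}) (T G : 'M[C]_n) :
  (forall j k, G j k = \sum_(i < n) \sum_(l < n) ((p j)`_i)^* * (p k)`_l * T i l) ->
  \det G = (\det (coef_mx n p))^* * \det (coef_mx n p) * \det T.
Proof.
move=> HG.
have -> : G = map_mx Num.conj (coef_mx n p) *m T *m (coef_mx n p)^T.
  apply/matrixP => j k; rewrite HG mxE exchange_big; apply: eq_bigr => l _.
  rewrite !mxE mulr_suml; apply: eq_bigr => i _.
  by rewrite !mxE mulrAC.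
by rewrite !det_mulmx det_map_mx det_tr mulrAC.
Qed.

Lemma horner_conj_mul n a b z : `|z| = 1 ->
  (size a <= n)%N -> (size b <= n)%N ->
  (a.[z])^* * b.[z] =
  \sum_(i < n) \sum_(l < n) (a`_i)^* * b`_l * z ^ (l%:Z - i%:Z).
Proof.
move=> z1 sa sb; have z0 : z != 0 by rewrite -normr_gt0 z1.
rewrite (horner_coef_wide _ sa) (horner_coef_wide _ sb) rmorph_sum mulr_suml.
apply: eq_bigr => i _; rewrite mulr_sumr; apply: eq_bigr => l _.
rewrite rmorphM rmorphXn /=.
have -> : z^* = z^-1 by rewrite invC_norm z1 expr1n invr1 mul1r.
have -> : z ^ (l%:Z - i%:Z) = z ^+ l * z^-1 ^+ i by rewrite expfzDr // exprVn exprnN.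
by ring.
Qed.

End ToeplitzBasis.

(** * Power series *)

Section PowerSums.
Variable C : numFieldType.
Implicit Types x y z : C.

Definition psum (c : nat -> C) N z : C := \sum_(k < N) c k * z ^+ k.
(** The termwise derivative of [psum]; its term of index 0 vanishes through the multiplicity [*+ k],
    so the value of [0.-1] does not matter. *)
Definition dpsum (c : nat -> C) N z : C := \sum_(k < N) c k * (z ^+ k.-1 *+ k).

(** The second order Taylor remainder of the k-th power. The crude factor 4^k keeps the bound
    geometric in k, ready to be summed, and rho^2 stands on the left so that k = 0 and k = 1 cause
    no negative exponent. *)
Lemma expr_remainder_le (rho x y : C) k : 0 < rho -> `|x| <= rho -> `|y| <= rho ->
  `|y ^+ k - x ^+ k - (y - x) * (x ^+ k.-1 *+ k)| * rho ^+ 2 <=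
  (4 * rho) ^+ k * `|y - x| ^+ 2.
Proof.
move=> rho0 xr yr; have rho0' := ltW rho0; elim: k => [|k IHk].
  by rewrite !expr0 mulr0n mulr0 subrr subr0 normr0 mul0r mul1r exprn_ge0.
set e := _ - _ - _ in IHk.
have -> : y ^+ k.+1 - x ^+ k.+1 - (y - x) * (x ^+ k.+1.-1 *+ k.+1) =
    y * e + (y - x) ^+ 2 * (x ^+ k.-1 *+ k).
  rewrite /e /=; case: k {IHk e} => [|k] /=; first by rewrite !mulr0n; ring.
  by rewrite -[_ *+ k.+2]mulr_natr -[_ *+ k.+1]mulr_natr !exprS; ring.
apply: (@le_trans _ _ ((rho * (`|e| * rho ^+ 2) + `|y - x| ^+ 2 * (rho ^+ k.+1 *+ k)))).
  apply: le_trans (ler_wpM2r _ (ler_normD _ _)) _; first by rewrite exprn_ge0.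
  rewrite !normrM -expr2 mulrDl -mulrA lerD //.
    by rewrite ler_wpM2r // mulr_ge0 // exprn_ge0.
  rewrite -mulrA ler_wpM2l ?exprn_ge0 //.
  case: k {IHk e} => [|k]; first by rewrite !mulr0n normr0 mul0r.
  rewrite normrMn mulrnAl lerMn2r /= normrX [rho ^+ k.+2]exprSr [rho ^+ k.+1]exprSr
    -[rho ^+ k * _ * _]mulrA -expr2.
  by rewrite ler_wpM2r ?exprn_ge0 // lerXn2r ?nnegrE.
apply: (@le_trans _ _ ((rho * (4 * rho) ^+ k + rho ^+ k.+1 *+ k) * `|y - x| ^+ 2)).
  rewrite mulrDl -mulrA lerD //; first by rewrite ler_wpM2l.
  by rewrite mulrC.
rewrite ler_wpM2r ?exprn_ge0 //.
rewrite !exprMn -[rho ^+ k.+1 *+ k]mulr_natl [rho * (_ * _)]mulrCA -[rho * rho ^+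
  k]exprS -mulrDl ler_wpM2r ?exprn_ge0 //.
rewrite -natrX -natrD -natrX ler_nat.
(* The induction closes because 4^k + k is at most 2 * 4^k. *)
rewrite expnS (@leq_trans (2 * 4 ^ k)) ?leq_mul2r ?orbT //.
by rewrite mul2n -addnn leq_add2l ltnW // ltn_expl.
Qed.

End PowerSums.

Section PowerSeries.
Variable C : numFieldType.
Implicit Types (F : C -> C) (a x y z : C).

Definition has_pseries F a (c : nat -> C) : Prop :=
  \forall z \near a, [series c k * (z - a) ^+ k]_k @ \oo --> F z.

Definition pseries_at F a : Prop := exists c, has_pseries F a c.

(** Convergence at the single point a + s bounds |c_k| s^k. The Taylor remainders then add up to a
    quadratic bound that does not depend on the truncation N, which later allows N to tend to
    infinity before or after y tends to x. *)
Lemma pseries_estimate F a c : has_pseries F a c ->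
  exists rho M : C, [/\ 0 < rho,
   forall x, `|x - a| <= rho -> psum c N (x - a) @[N --> \oo] --> F x &
   forall x y, `|x - a| <= rho -> `|y - a| <= rho -> forall N,
     `|psum c N (y - a) - psum c N (x - a) - (y - x) * dpsum c N (x - a)| <=
       M * `|y - x| ^+ 2].
Proof.
move=> /nbhs_normP[e /= e0 He].
have psumE z : psum c ^~ z = series (fun k => c k * z ^+ k).
  by apply/funext => N; rewrite /psum /series /= big_mkord.
pose s := e / 2.
have s0 : 0 < s by rewrite divr_gt0.
have se : s < e by rewrite ltr_pdivrMr // mulr_natr mulr2n ltrDl.
(* With this choice 4 rho = s / 2, so the remainders are dominated by a geometric series of ratio
   1/2, whose sum 2 is the last factor of the constant. *)
pose rho := s / 8.
have rho0 : 0 < rho by rewrite divr_gt0.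
have re : rho < e.
  by rewrite (le_lt_trans _ se) // ler_pdivrMr // ler_pMr // ler1n.
have [M M0 HM] : exists2 M, 0 < M & forall k, `|c k| * s ^+ k <= M.
  have /He cvs : `|a - (a + s)| < e by rewrite opprD addrA subrr sub0r normrN gtr0_norm.
  have {}cvs := cvgP _ cvs.
  have [M [Mr HM]] := cvg_seq_bounded (cvgP _ (cvg_series_cvg_0 cvs)).
  exists (`|M| + 1); first by rewrite ltr_wpDl.
  have MM : M < `|M| + 1 by rewrite (le_lt_trans (real_ler_norm Mr)) // ltrDl.
  move=> k; have := HM _ MM k I.
  by rewrite /= addrAC subrr add0r normrM normrX (gtr0_norm s0).
exists rho, (M / rho ^+ 2 * 2); split => // [x xr|x y xr yr N].
  by rewrite psumE; apply: He; rewrite /= distrC (le_lt_trans xr).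
set u := x - a; set v := y - a.
have -> : y - x = v - u by rewrite /u /v; ring.
rewrite /psum /dpsum mulr_sumr -!sumrB (le_trans (ler_norm_sum _ _ _)) //.
apply: (@le_trans _ _ (\sum_(k < N) M / rho ^+ 2 * `|v - u| ^+ 2 * (2^-1) ^+ k)).
  apply: ler_sum => k _.
  rewrite mulrCA -!mulrBr normrM.
  have := expr_remainder_le k rho0 xr yr; rewrite -/u -/v => H.
  rewrite -ler_pdivlMr ?exprn_gt0 // in H.
  rewrite (le_trans (ler_wpM2l _ H)) //.
  have -> : 4 * rho = s * 2^-1 by rewrite /rho; field.
  rewrite exprMn [leLHS](_ : _ = (`|c k| * s ^+ k) * ((rho ^+ 2)^-1 * `|v - u| ^+ 2 *
    2^-1 ^+ k)); last first.
    by field; rewrite gt_eqF.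
  rewrite [leRHS](_ : _ = M * ((rho ^+ 2)^-1 * `|v - u| ^+ 2 * 2^-1 ^+ k)); last first.
    by field; rewrite gt_eqF.
  by rewrite ler_wpM2r // !mulr_ge0 ?invr_ge0 ?exprn_ge0 ?invr_ge0 // ltW.
rewrite -mulr_sumr [leRHS]mulrAC ler_wpM2l //.
  by rewrite mulr_ge0 ?exprn_ge0 // divr_ge0 ?exprn_ge0 ?ltW.
have : \sum_(k < N) (2^-1 : C) ^+ k = 2 - 2 * 2^-1 ^+ N.
  elim: N => [|N IHN]; first by rewrite big_ord0 expr0 mulr1 subrr.
  by rewrite big_ord_recr /= IHN exprS; field.
by move=> ->; rewrite gerBl mulr_ge0 // exprn_ge0 // invr_ge0.
Qed.

End PowerSeries.

(** * Derivatives as first order approximations *)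

Section Derive.
Variable K : numFieldType.
Implicit Types (F : K -> K) (a d x y z : K).

Lemma is_derive_approx F a d : is_derive a 1 F d <->
  forall e, 0 < e -> \forall z \near a, `|F z - F a - (z - a) * d| <= e * `|z - a|.
Proof.
split=> [dF e e0|H].
  have /cvgrPdist_le/(_ e e0)/nbhs_normP[r /= r0 Hr] : h^-1 *: ((F \o shift a) (h *:
    1) - F a) @[h --> 0^'] --> d.
    by have [dFa <-] := dF; exact: dFa.
  apply/nbhs_normP; exists r => // z /= zr.
  have [->|za] := eqVneq z a; first by rewrite !subrr mul0r subr0 normr0 mulr0.
  have za0 : z - a != 0 by rewrite subr_eq0.
  have := Hr (z - a); rewrite /= sub0r opprB => /(_ zr za0).
  rewrite /shift /= scaler1 subrK => {}Hr.
  rewrite distrC -[X in X - (_ - _)]mulr1 -ler_pdivrMr ?normr_gt0 // -normfV -normrM.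
  by move: Hr; congr (`|_| <= _); rewrite /GRing.scale /=; field.
suff cv : h^-1 *: ((F \o shift a) (h *: 1) - F a) @[h --> 0^'] --> d.
  apply: DeriveDef; first by apply/cvg_ex; exists d.
  exact: cvg_lim.
apply/cvgrPdist_le => e e0.
have /nbhs_normP[r /= r0 Hr] := H e e0.
apply/nbhs_normP; exists r => // h /=; rewrite sub0r normrN => hr h0.
have := Hr (h + a); rewrite /= opprD addrCA subrr addr0 normrN => /(_ hr).
rewrite addrK distrC -ler_pdivrMr ?normr_gt0 // -normfV -normrM.
rewrite /shift /= scaler1 => {}Hr.
by move: Hr; congr (`|_| <= _); rewrite /GRing.scale /=; field.
Qed.

Lemma derivable_derive1 F a : derivable F a 1 -> is_derive a 1 F (derive1 F a).
Proof. by rewrite derive1E => /derivableP. Qed.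

Lemma is_derive_derive1 F a d : is_derive a 1 F d -> derive1 F a = d.
Proof. by rewrite derive1E => -[_ ->]. Qed.

Lemma is_derive_cvg_slope F a d : is_derive a 1 F d ->
  (F z - F a) / (z - a) @[z --> a^'] --> d.
Proof.
move=> /is_derive_approx H; apply/cvgrPdist_le => e e0.
have /nbhs_normP[r /= r0 Hr] := H e e0.
apply/nbhs_normP; exists r => // z /= zr za.
have za0 : z - a != 0 by rewrite subr_eq0.
have := Hr z zr; rewrite distrC -ler_pdivrMr ?normr_gt0 // -normfV -normrM.
by congr (`|_| <= _); field.
Qed.

Lemma is_derive_continuous F a d : is_derive a 1 F d -> {for a, continuous F}.
Proof.
move=> dF; have : derivable F a 1 by case: dF.
by move/derivable1_diffP/differentiable_continuous.
Qed.

Lemma norm_cvg_le (u : nat -> K) l B : u N @[N --> \oo] --> l ->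
  (\forall N \near \oo, `|u N| <= B) -> `|l| <= B.
Proof.
move=> ul uB; apply/ler_addgt0Pr => e e0.
have H : \forall N \near \oo, `|l| <= B + e.
  near=> N.
  rewrite -[l](subrK (u N)) addrC (le_trans (ler_normD _ _)) // lerD //.
    by near: N.
  by near: N; move/cvgrPdist_le : ul; exact.
by have [N _ /(_ N (leqnn N))] := H.
Unshelve. all: by end_near. Qed.

End Derive.

Section PowerSeriesDerive.
Variable C : numFieldType.
Implicit Types (F : C -> C) (a x y z : C).

Lemma dpsum_at0 (c : nat -> C) N : dpsum c N.+2 0 = c 1.
Proof.
rewrite /dpsum !big_ord_recl mulr0n mulr0 add0r expr0 mulr1n mulr1.
by rewrite big1 ?addr0 // => i _; rewrite expr0n mul0rn mulr0.
Qed.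

(** Put x = a in the estimate, where the truncated derivative is [c 1], and let N tend to infinity:
    F differs from its first order expansion by at most M |z - a|^2. *)
Lemma has_pseries_derive F a c : has_pseries F a c -> is_derive a 1 F (c 1).
Proof.
move=> /pseries_estimate[rho [M [rho0 cF est]]].
have aa : `|a - a| <= rho by rewrite subrr normr0 ltW.
apply/is_derive_approx => e e0.
(* The estimate for N = 0 has left-hand side 0. *)
have M0 : 0 <= M.
  have := est a (a + rho) aa; rewrite addrAC subrr add0r gtr0_norm // => /(_ (lexx _)
    0).
  rewrite /psum /dpsum !big_ord0 subrr mulr0 subrr normr0 => H.
  by rewrite -(pmulr_lge0 _ (exprn_gt0 2 rho0)).
have near1 : \forall z \near a, `|a - z| < rho.
  by apply/nbhs_normP; exists rho.
have near2 : \forall z \near a, `|a - z| < e / (M + 1).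
  by apply/nbhs_normP; exists (e / (M + 1)) => //=; rewrite divr_gt0 // ltr_wpDl.
near=> z.
have zr : `|z - a| <= rho by rewrite distrC ltW //; near: z.
apply: (@le_trans _ _ (M * `|z - a| ^+ 2)).
  apply: (@norm_cvg_le _ (fun N => psum c N (z - a) - psum c N (a - a) - (z - a) * c
    1)).
    by apply: cvgB; [apply: cvgB; exact: cF | exact: cvg_cst].
  exists 2%N => // -[|[|N]] //= _.
  by have := est a z aa zr N.+2; rewrite subrr dpsum_at0.
rewrite expr2 mulrA ler_wpM2r // (@le_trans _ _ ((M + 1) * `|z - a|)) //.
  by rewrite ler_wpM2r // lerDl.
rewrite mulrC -ler_pdivlMr ?ltr_wpDl // distrC ltW //; near: z; exact: near2.
Unshelve. all: by end_near. Qed.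

Lemma pseries_at_derivable F a : pseries_at F a -> derivable F a 1.
Proof. by move=> [c /has_pseries_derive[]]. Qed.

(* The remainder bound of [pseries_estimate] is uniform in the truncation, so
   the truncated derivatives converge to the derivative of [F]. *)
Lemma pseries_derive (Omega : set C) F : open Omega ->
  (forall a, Omega a -> pseries_at F a) -> forall a, Omega a -> pseries_at (derive1
    F) a.
Proof.
move=> oO aF a Oa.
have [c /pseries_estimate[rho [M [rho0 cF est]]]] := aF a Oa.
exists (fun k => c k.+1 *+ k.+1).
have near1 : \forall x \near a, `|a - x| < rho.
  by apply/nbhs_normP; exists rho.
have near2 : \forall x \near a, Omega x by apply: open_nbhs_nbhs.
near=> x.
have xr : `|x - a| < rho by rewrite distrC; near: x.
have Ox : Omega x by near: x.
have dF : is_derive x 1 F (derive1 F x).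
  by apply: derivable_derive1; apply: pseries_at_derivable; exact: aF.
suff H : dpsum c N (x - a) @[N --> \oo] --> derive1 F x.
  rewrite [X in X @ _ --> _](_ : _ = (fun N => dpsum c (N + 1)%N (x - a))).
    by rewrite (cvg_shiftn 1 (fun N => dpsum c N (x - a))).
  apply/funext => N; rewrite /series /= /dpsum addn1 big_ord_recl mulr0n mulr0 add0r.
  by rewrite big_mkord; apply: eq_bigr => k _; rewrite /= mulrnAl mulrnAr.
apply/cvgrPdist_le => e e0.
have M0 : 0 <= M.
  have aa : `|a - a| <= rho by rewrite subrr normr0 ltW.
  have := est a (a + rho) aa; rewrite addrAC subrr add0r gtr0_norm // => /(_ (lexx _)
    0).
  rewrite /psum /dpsum !big_ord0 subrr mulr0 subrr normr0 => H.
  by rewrite -(pmulr_lge0 _ (exprn_gt0 2 rho0)).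
have e3 : 0 < e / 3 by rewrite divr_gt0.
(* One auxiliary point y is fixed before N is chosen, so the difference quotient over y - x has a
   fixed denominator; three errors of size e / 3 then remain. *)
have [y [yx yr yM yd]] : exists y, [/\ y != x, `|y - a| <= rho, M * `|y - x| <= e / 3 &
    `|F y - F x - (y - x) * derive1 F x| <= e / 3 * `|y - x|].
  move/is_derive_approx : dF => /(_ _ e3) dF.
  have near3 : \forall y \near x, `|a - y| < rho.
    have : open (ball_ Num.norm a rho) by exact: (@ball_open _ C).
    by move=> ob; apply: open_nbhs_nbhs; split => //; rewrite /ball_ /= distrC.
  have near4 : \forall y \near x, `|x - y| < e / 3 / (M + 1).
    by apply/nbhs_normP; exists (e / 3 / (M + 1)) => //=; rewrite divr_gt0 // ltr_wpDl.
  have /nbhs_normP[r /= r0 Hr] : \forall y \near x, [/\ `|y - a| <= rho, M * `|y - x|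
    <= e / 3 &
    `|F y - F x - (y - x) * derive1 F x| <= e / 3 * `|y - x|].
    near=> y; split; last by near: y.
      by rewrite distrC ltW //; near: y.
    apply: (@le_trans _ _ ((M + 1) * `|y - x|)).
      by rewrite ler_wpM2r // lerDl.
    by rewrite mulrC -ler_pdivlMr ?ltr_wpDl // distrC ltW //; near: y; exact: near4.
  exists (x + r / 2).
  have r2 : 0 < r / 2 by rewrite divr_gt0.
  have [|? ? ?] := Hr (x + r / 2).
    by rewrite /= opprD addrA subrr sub0r normrN gtr0_norm // ltr_pdivrMr //
      mulr_natr mulr2n ltrDl.
  by split => //; rewrite -subr_eq0 addrAC subrr add0r gt_eqF.
have yx0 : 0 < `|y - x| by rewrite normr_gt0 subr_eq0.
have xr' := ltW xr.
have H1 : psum c N (y - a) - psum c N (x - a) @[N --> \oo] --> F y - F x.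
  by apply: cvgB; exact: cF.
have e3y : 0 < e / 3 * `|y - x| by rewrite mulr_gt0.
move/cvgrPdist_le/(_ _ e3y) : H1 => H1.
near=> N.
rewrite -(ler_pM2r yx0) -normrM.
have -> : (derive1 F x - dpsum c N (x - a)) * (y - x) =
   (psum c N (y - a) - psum c N (x - a) - (y - x) * dpsum c N (x - a)) +
   (F y - F x - (psum c N (y - a) - psum c N (x - a)) -
     (F y - F x - (y - x) * derive1 F x)) by ring.
rewrite (le_trans (ler_normD _ _)) // (_ : e * _ = e / 3 * `|y - x| + (e / 3 * `|y -
  x| + e / 3 * `|y - x|)); last by field.
apply: lerD.
  by rewrite (le_trans (est x y xr' yr N)) // expr2 mulrA ler_wpM2r.
by rewrite (le_trans (ler_normB _ _)) // lerD //; near: N.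
Unshelve. all: by end_near. Qed.

(** The constant coefficient is F a = 0, so dividing by z - a shifts the coefficients; the shifted
    series takes at a the value [c 1], which is the derivative. *)
Lemma pseries_at_div_zero F a : pseries_at F a -> F a = 0 ->
  pseries_at (fun z => if z == a then derive1 F a else F z / (z - a)) a.
Proof.
move=> [c Hc] Fa0.
have c0 : c 0 = 0.
  have := nbhs_singleton Hc; rewrite subrr Fa0 => H.
  have : series (fun k => c k * 0 ^+ k) N @[N --> \oo] --> c 0.
    apply: cvg_near_cst; exists 1%N => // -[|N] //= _.
    rewrite /series /= big_mkord big_ord_recl expr0 mulr1 big1 ?addr0 // => i _.
    by rewrite expr0n mulr0.
  by move/cvg_lim => <- //; exact/cvg_lim.
have cS z : z != a -> series (fun k => c k * (z - a) ^+ k) N @[N --> \oo] --> F z ->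
    series (fun k => c k.+1 * (z - a) ^+ k) N @[N --> \oo] --> F z / (z - a).
  move=> za H; have za0 : z - a != 0 by rewrite subr_eq0.
  rewrite [X in X @ _ --> _](_ : _ = (fun N => series (fun k => c k * (z - a) ^+ k)
    (N + 1)%N / (z - a))).
    by apply: cvgMl; rewrite (cvg_shiftn 1 (series (fun k => c k * (z - a) ^+ k))).
  apply/funext => N; rewrite /series /= !big_mkord addn1 big_ord_recl c0 mul0r add0r.
  rewrite mulr_suml; apply: eq_bigr => k _; rewrite /= exprS.
  by field.
exists (fun k => c k.+1).
near=> z; have Hz : series (fun k => c k * (z - a) ^+ k) N @[N --> \oo] --> F z by
  near: z.
case: eqVneq => [->|za]; last exact: cS.
rewrite subrr.
rewrite (is_derive_derive1 (has_pseries_derive Hc)).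
apply: cvg_near_cst; exists 1%N => // -[|N] //= _.
rewrite /series /= big_mkord big_ord_recl expr0 mulr1 big1 ?addr0 // => i _.
by rewrite expr0n mulr0.
Unshelve. all: by end_near. Qed.

End PowerSeriesDerive.

(** * Complex-valued functions on circles *)

Section ComplexTopology.
Variable R : realType.
Local Notation C := (cplx R).
Local Notation Re := (@complex.Re R).
Local Notation Im := (@complex.Im R).
Implicit Types (z w : C) (e x y : R).

(** Positive elements of C are real, which reduces every epsilon of the complex topology to a real
    one. *)
Lemma gt0_realC (e : C) : 0 < e -> exists2 d : R, 0 < d & e = (d%:C)%C.
Proof. by case: e => a b; rewrite ltcE /= => /andP[/eqP -> a0]; exists a. Qed.

Lemma norm_Re_le z : (`|Re z|%:C)%C <= `|z|.
Proof. exact: normc_ge_Re. Qed.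

Lemma norm_Im_le z : (`|Im z|%:C)%C <= `|z|.
Proof. by rewrite normc_def lecR -sqrtr_sqr ler_wsqrtr // lerDr sqr_ge0. Qed.

Lemma norm_le_Re_Im z : `|z| <= ((`|Re z| + `|Im z|)%:C)%C.
Proof.
rewrite normc_def lecR -[leRHS]ger0_norm ?addr_ge0 // -sqrtr_sqr ler_wsqrtr //.
by rewrite sqrrD !real_normK ?num_real // -addrA lerD2l lerDr mulrn_wge0 // mulr_ge0.
Qed.

Lemma ReM z w : Re (z * w) = Re z * Re w - Im z * Im w.
Proof. by case: z w => ? ? [? ?]. Qed.

Lemma ImM z w : Im (z * w) = Re z * Im w + Im z * Re w.
Proof. by case: z w => ? ? [? ?]. Qed.

Lemma ReD z w : Re (z + w) = Re z + Re w.
Proof. by case: z w => ? ? [? ?]. Qed.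

Lemma ImD z w : Im (z + w) = Im z + Im w.
Proof. by case: z w => ? ? [? ?]. Qed.

Lemma ReN z : Re (- z) = - Re z.
Proof. by case: z. Qed.

Lemma ImN z : Im (- z) = - Im z.
Proof. by case: z. Qed.

Lemma Re_conj z : Re z^* = Re z.
Proof. by case: z. Qed.

Lemma Im_conj z : Im z^* = - Im z.
Proof. by case: z. Qed.

Lemma cvg_Re (T : Type) (F : set_system T) {FF : Filter F} (h : T -> C) z :
  h s @[s --> F] --> z -> Re (h s) @[s --> F] --> Re z.
Proof.
move=> hz; apply/cvgrPdist_lt => e e0.
have e0' : 0 < ((e%:C)%C : C) by rewrite ltcR.
move/cvgrPdist_lt : hz => /(_ _ e0'); apply: filterS => s.
move/(le_lt_trans (norm_Re_le _)); rewrite ltcR.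
by rewrite ReD ReN.
Qed.

Lemma cvg_Im (T : Type) (F : set_system T) {FF : Filter F} (h : T -> C) z :
  h s @[s --> F] --> z -> Im (h s) @[s --> F] --> Im z.
Proof.
move=> hz; apply/cvgrPdist_lt => e e0.
have e0' : 0 < ((e%:C)%C : C) by rewrite ltcR.
move/cvgrPdist_lt : hz => /(_ _ e0'); apply: filterS => s.
move/(le_lt_trans (norm_Im_le _)); rewrite ltcR.
by rewrite ImD ImN.
Qed.

Lemma cvg_complex (T : Type) (F : set_system T) {FF : Filter F} (f g : T -> R) x y :
  f s @[s --> F] --> x -> g s @[s --> F] --> y ->
  ((f s +i* g s)%C : C) @[s --> F] --> ((x +i* y)%C : C).
Proof.
move=> fx gy; apply/cvgrPdist_lt => e' /gt0_realC[e e0 ->].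
have e20 : 0 < e / 2 by rewrite divr_gt0.
have fxe := (cvgrPdist_lt _ _).1 fx _ e20.
have gye := (cvgrPdist_lt _ _).1 gy _ e20.
near=> s; apply: le_lt_trans (norm_le_Re_Im _) _; rewrite ltcR ReD ImD /=.
by rewrite [e]splitr ltrD //; near: s; [exact: fxe | exact: gye].
Unshelve. all: by end_near. Qed.

End ComplexTopology.

Section CurveDerivative.
Variable R : realType.
Local Notation C := (cplx R).
Local Notation Re := (@complex.Re R).
Local Notation Im := (@complex.Im R).

(** Chain rule for a real curve in the complex plane. The slope function [phi], continuous at the
    base point, replaces the difference quotient of F, because the curve may return to its base
    point and make the denominator vanish. *)
Lemma is_derive_Re_curve (F : C -> C) (d : C) (x y : R -> R) (t x' y' : R) :
  is_derive ((x t +i* y t)%C : C) 1 F d ->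
  is_derive t 1 x x' -> is_derive t 1 y y' ->
  is_derive t 1 (fun s => Re (F (x s +i* y s)%C)) (Re (d * (x' +i* y')%C)).
Proof.
move=> dF dx dy.
pose g s : C := (x s +i* y s)%C.
pose phi z := if z == g t then d else (F z - F (g t)) / (z - g t).
have Fphi z : F z - F (g t) = phi z * (z - g t).
  rewrite /phi; case: eqVneq => [->|zg]; first by rewrite !subrr mulr0.
  by rewrite divfK // subr_eq0.
have phit : phi (g t) = d by rewrite /phi eqxx.
have phic : phi z @[z --> g t] --> d.
  have := is_derive_cvg_slope dF; rewrite -/(g t) => H.
  rewrite -phit; apply/continuous_withinNx; rewrite phit.
  apply: cvg_trans H; apply: near_eq_cvg.
  by near=> z; rewrite /phi ifF //; apply/negbTE; near: z; exact: nbhs_dnbhs_neq.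
have cx := is_derive_continuous dx; have cy := is_derive_continuous dy.
have gc : g s @[s --> t] --> g t by exact: cvg_complex.
have pgc : phi (g s) @[s --> t] --> d by apply: cvg_comp gc phic.
have sx := is_derive_cvg_slope dx; have sy := is_derive_cvg_slope dy.
suff H : (Re (F (g s)) - Re (F (g t))) / (s - t) @[s --> t^'] --> Re (d * (x' +i*
  y')%C).
  apply/is_derive_approx => e e0.
  move/cvgrPdist_le : H => /(_ e e0) /nbhs_normP[r /= r0 Hr].
  apply/nbhs_normP; exists r => // s /= sr.
  have [->|st] := eqVneq s t; first by rewrite !subrr mul0r subr0 normr0 mulr0.
  have st0 : s - t != 0 by rewrite subr_eq0.
  have Hs := Hr s sr st.
  rewrite -ler_pdivrMr ?normr_gt0 // -normfV -normrM.
  by move: Hs; rewrite distrC; congr (`|_| <= _); field.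
rewrite ReM /=.
have -> : (fun s => (Re (F (g s)) - Re (F (g t))) / (s - t)) =
  (fun s => Re (phi (g s)) * ((x s - x t) / (s - t)) - Im (phi (g s)) * ((y s - y t)
    / (s - t))).
  apply/funext => s.
  by rewrite -ReN -ReD Fphi ReM /= ; ring.
have pgc' : phi (g s) @[s --> t^'] --> d by apply: cvg_within_filter pgc.
apply: cvgB; apply: cvgM => //; [exact: cvg_Re | exact: cvg_Im].
Unshelve. all: by end_near. Qed.

End CurveDerivative.

Section CirclePoint.
Variable R : realType.
Local Notation C := (cplx R).
Local Notation Re := (@complex.Re R).
Local Notation Im := (@complex.Im R).
Implicit Types (r t : R) (F : C -> C).

Definition unit_point t : C := (cos t +i* sin t)%C.

Lemma circle_pointE r t : circle_point r t = (r%:C)%C * unit_point t.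
Proof. by rewrite /circle_point /unit_point; simpc. Qed.

Lemma norm_unit_point t : `|unit_point t| = 1.
Proof. by rewrite normc_def /= cos2Dsin2 sqrtr1. Qed.

Lemma norm_circle_point r t : 0 <= r -> `|circle_point r t| = (r%:C)%C.
Proof.
move=> r0; rewrite circle_pointE normrM norm_unit_point mulr1.
by rewrite ger0_norm // ler0c.
Qed.

Lemma circle_circle_point r t : 0 <= r -> circle r (circle_point r t).
Proof. exact: norm_circle_point. Qed.

Lemma circle_point_neq0 r t : 0 < r -> circle_point r t != 0.
Proof. by move=> r0; rewrite -normr_gt0 norm_circle_point ?ltW // ltcR. Qed.

Lemma circle_point_2pi r : circle_point r (2 * pi) = circle_point r 0.
Proof. by rewrite /circle_point mulr_natl cos2pi sin2pi cos0 sin0. Qed.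

Lemma cvg_circle_point (T : Type) (G : set_system T) {FG : Filter G}
    (f g : T -> R) r t :
  f s @[s --> G] --> r -> g s @[s --> G] --> t ->
  circle_point (f s) (g s) @[s --> G] --> circle_point r t.
Proof.
move=> fr gt; apply: cvg_complex; apply: cvgM => //.
  by apply: cvg_comp gt _; exact: continuous_cos.
by apply: cvg_comp gt _; exact: continuous_sin.
Qed.

Lemma cvg_unit_point (T : Type) (G : set_system T) {FG : Filter G}
    (g : T -> R) t :
  g s @[s --> G] --> t -> unit_point (g s) @[s --> G] --> unit_point t.
Proof.
move=> gt; apply: cvg_complex.
  by apply: cvg_comp gt _; exact: continuous_cos.
by apply: cvg_comp gt _; exact: continuous_sin.
Qed.

Lemma is_derive_Re_radius F d r t : is_derive (circle_point r t) 1 F d ->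
  is_derive r 1 (fun s => Re (F (circle_point s t))) (Re (d * unit_point t)).
Proof.
move=> dF; apply: (@is_derive_Re_curve R F d (fun s => s * cos t) (fun s => s * sin
  t)) => //.
  by apply: is_derive_eq; rewrite scaler0 add0r /GRing.scale /= mulr1.
by apply: is_derive_eq; rewrite scaler0 add0r /GRing.scale /= mulr1.
Qed.

Lemma is_derive_Re_angle F d r t : is_derive (circle_point r t) 1 F d ->
  is_derive t 1 (fun s => Re (F (circle_point r s)))
    (Re (d * ('i%C * circle_point r t))).
Proof.
move=> dF; have -> : ('i%C * circle_point r t : C) = (r * - sin t +i* (r * cos t))%C.
  by rewrite /circle_point; simpc.
apply: (@is_derive_Re_curve R F d (fun s => r * cos s) (fun s => r * sin s)) => //.
Qed.

End CirclePoint.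

Section CompactCircle.
Variable R : realType.
Local Notation C := (cplx R).

(** The tube lemma for the compact interval of angles. *)
Lemma near_circle (P : R -> R -> Prop) (r : R) :
  (forall t : R, \forall t' \near nbhs t & s \near nbhs r, P s t') ->
  \forall s \near r, forall t, t \in `[0, 2 * pi] -> P s t.
Proof.
move=> H; have /compact_near_coveringP cov := @segment_compact R 0 (2 * pi).
have near_sub := cov R (nbhs r) P _ (fun t _ => H t).
near=> s => t tI; have Ps : `[0, 2 * pi] `<=` P s by near: s; exact: near_sub.
exact: Ps.
Unshelve. all: by end_near. Qed.

(** The bound is made a parameter of the covering argument, ranging over neighbourhoods of +oo, so
    compactness yields one bound for all angles together with the neighbourhood of [r]. *)
Lemma bounded_near_arc (w : R -> R -> R) r :
  (forall t, w p.1 p.2 @[p --> (r, t)] --> w r t) ->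
  exists M, \forall s \near r, forall t, t \in `[0, 2 * pi] -> `|w s t| <= M.
Proof.
move=> wc.
have H : \forall s \near nbhs r & M \near pinfty_nbhs R, forall t, t \in `[0, 2 * pi]
  -> `|w s t| <= M.
  have /compact_near_coveringP cov := @segment_compact R 0 (2 * pi).
  have H := cov (R * R)%type (filter_prod (nbhs r) (pinfty_nbhs R)) (fun p t => `|w
    p.1 t| <= p.2) _.
  have : \forall p \near filter_prod (nbhs r) (pinfty_nbhs R), `[0, 2 * pi] `<=` [set
    t | `|w p.1 t| <= p.2].
    apply: H => t _.
    have /cvgrPdist_le /(_ 1 ltr01) [[A B] /= [nA nB] AB] := wc t.
    near=> t' p.
    have p1 : A p.1 by near: p; exists (A, setT) => //=; [split => //; exact: filterT
      | move=> [? ?] []].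
    have p2 : `|w r t| + 1 <= p.2.
      near: p; exists (setT, [set M | `|w r t| + 1 <= M]) => /=; last by move=> [? ?]
        [].
      split; first exact: filterT.
      by exists (`|w r t| + 1); split; [exact: num_real | move=> M /= /ltW].
    apply: le_trans p2; have : B t' by near: t'.
    move=> Bt'; have := AB (p.1, t') (conj p1 Bt') => /= wle.
    rewrite -[w p.1 t'](subrK (w r t)) addrC (le_trans (ler_normD _ _)) // lerD2l.
    by rewrite distrC.
  by apply: filterS => -[s M] /= HM t tI; exact: HM.
have [[A B] /= [nA nB] AB] := H.
have [M [_ BM]] := nB; have {}BM : B (M + 1) by apply: BM; rewrite ltrDl.
exists (M + 1); apply: filterS nA => s As t tI.
exact: (AB (s, M + 1)).
Unshelve. all: by end_near. Qed.

End CompactCircle.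

(** * Circle integrals as functions of the radius *)

Section RadialDerivative.
Variable R : realType.
Local Notation C := (cplx R).
Local Notation Re := (@complex.Re R).
Local Notation Im := (@complex.Im R).
Local Notation mu := (@lebesgue_measure R).
Implicit Types (r s t u v : R) (F : C -> C).

(** Holomorphy in the form that differentiation under the integral requires. Its stability under
    sums, products and inverses is elementary, whereas power series would have to be multiplied and
    inverted. *)
Definition smooth_at F (z : C) : Prop := exists2 dF : C -> C,
  (\forall w \near z, is_derive (w : C) 1 F (dF w)) & {for z, continuous dF}.

Lemma smooth_at_derivable F z : smooth_at F z -> is_derive z 1 F (derive1 F z).
Proof.
move=> [dF /nbhs_singleton dFz _]; rewrite (is_derive_derive1 dFz); exact: dFz.
Qed.

Lemma smooth_at_derive1 F z : smooth_at F z -> {for z, continuous (derive1 F)}.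
Proof.
move=> [dF near_dF cdF].
have dFz := nbhs_singleton near_dF.
suff H : derive1 F w @[w --> z] --> dF z.
  by move: H; rewrite -[X in _ --> X](is_derive_derive1 dFz).
have E : {near nbhs z, dF =1 derive1 F}.
  near=> w; symmetry; apply: is_derive_derive1.
  by near: w; exact: near_dF.
exact: cvg_trans (near_eq_cvg E) cdF.
Unshelve. all: by end_near. Qed.

Lemma continuous_integrable (h : R -> R) a b : continuous h ->
  mu.-integrable `[a, b] (EFin \o h).
Proof.
move=> ch; apply: continuous_compact_integrable; first exact: segment_compact.
exact: continuous_subspaceT.
Qed.

Lemma continuous_arc F r : (forall t, {for circle_point r t, continuous F}) ->
  continuous (fun t => F (circle_point r t)).
Proof.
move=> cF t; apply: (@cvg_comp _ _ _ (circle_point r) F _ _ _ _ (cF t)).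
by apply: (@cvg_circle_point R R (nbhs t) _ (fun=> r) id r t); [exact: cvg_cst |
  exact: cvg_id].
Qed.

Lemma continuous_circle_joint F r t : {for circle_point r t, continuous F} ->
  F (circle_point p.1 p.2) @[p --> (r, t)] --> F (circle_point r t).
Proof.
move=> cF; apply: (@cvg_comp _ _ _ (fun p => circle_point p.1 p.2) F _ _ _ _ cF).
by apply: (@cvg_circle_point R _ _ _ fst snd r t); [exact: cvg_fst | exact: cvg_snd].
Qed.

Lemma smooth_at_continuous F z : smooth_at F z -> {for z, continuous F}.
Proof. by move=> /smooth_at_derivable dF; exact: is_derive_continuous dF. Qed.

Lemma smooth_at_cst (c z : C) : smooth_at (fun=> c) z.
Proof.
exists (fun=> 0); last by apply: cst_continuous.
by near=> w; exact: is_derive_cst.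
Unshelve. all: by end_near. Qed.

Lemma smooth_at_id (z : C) : smooth_at id z.
Proof.
exists (fun=> 1); last by apply: cst_continuous.
by near=> w; exact: is_derive_id.
Unshelve. all: by end_near. Qed.

Lemma smooth_atD F G (z : C) : smooth_at F z -> smooth_at G z ->
  smooth_at (fun w => F w + G w) z.
Proof.
move=> [dF nF cF] [dG nG cG]; exists (fun w => dF w + dG w).
  near=> w; apply: (@is_deriveD _ _ _ F G); near: w; [exact: nF | exact: nG].
exact: continuousD cF cG.
Unshelve. all: by end_near. Qed.

Lemma smooth_atM F G (z : C) : smooth_at F z -> smooth_at G z ->
  smooth_at (fun w => F w * G w) z.
Proof.
move=> sF sG; have cF := smooth_at_continuous sF; have cG := smooth_at_continuous sG.
move: sF sG => [dF nF cdF] [dG nG cdG]; exists (fun w => F w * dG w + G w * dF w).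
  near=> w; apply: (@is_deriveM _ _ F G); near: w; [exact: nF | exact: nG].
exact: continuousD (continuousM cF cdG) (continuousM cG cdF).
Unshelve. all: by end_near. Qed.

Lemma smooth_atV F (z : C) : F z != 0 -> smooth_at F z ->
  smooth_at (fun w => (F w)^-1) z.
Proof.
move=> Fz sF; have cF := smooth_at_continuous sF.
move: sF => [dF nF cdF]; exists (fun w => - ((F w)^-1 * ((F w)^-1 * dF w))).
  near=> w; have dFw : is_derive w 1 F (dF w) by near: w; exact: nF.
  have Fw : F w != 0 by near: w; exact: (cvgr_neq0 _ cF).
  have exF : derivable F w 1 by exact: (@ex_derive _ _ _ _ _ _ _ dFw).
  have dV : derivable (fun y => (F y)^-1) w 1 by exact: derivableV Fw exF.
  apply: DeriveDef; first exact: dV.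
  rewrite (deriveV Fw exF) (@derive_val _ _ _ _ _ _ _ dFw) /GRing.scale /= expr2 invfM.
  by rewrite mulNr mulrA.
have cV : {for z, continuous (fun w => (F w)^-1)} by exact: (@continuousV C C F z Fz
  cF).
have cVd : {for z, continuous (fun w => (F w)^-1 * dF w)} by exact: continuousM cV cdF.
have cVV : {for z, continuous (fun w => (F w)^-1 * ((F w)^-1 * dF w))} by exact:
  continuousM cV cVd.
exact: continuousN cVV.
Unshelve. all: by end_near. Qed.

Lemma smooth_at_sum (I : eqType) (s : seq I) (F : I -> C -> C) (z : C) :
  (forall i, i \in s -> smooth_at (F i) z) -> smooth_at (fun w => \sum_(i <- s) F i
    w) z.
Proof.
elim: s => [|i s IHs] sF.
  rewrite (_ : (fun _ => _) = (fun=> 0)); first exact: smooth_at_cst.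
  by apply/funext => w; rewrite big_nil.
rewrite (_ : (fun _ => _) = (fun w => F i w + \sum_(j <- s) F j w)).
  apply: smooth_atD; first by apply: sF; rewrite mem_head.
  by apply: IHs => j js; apply: sF; rewrite inE js orbT.
by apply/funext => w; rewrite big_cons.
Qed.

Lemma smooth_at_near_eq F G (z : C) : (\forall w \near z, F w = G w) ->
  smooth_at F z -> smooth_at G z.
Proof.
move=> FG [dF nF cF]; exists dF => //.
have FG' := @near_join C z (fun w => F w = G w) FG.
near=> w; have dFw : is_derive w 1 F (dF w) by near: w; exact: nF.
have FGw : \forall x \near w, F x = G x by near: w.
apply/is_derive_approx => e e0; have := (is_derive_approx F w (dF w)).1 dFw e e0.
move=> H; near=> x.
rewrite -(nbhs_singleton FGw) -(_ : F x = G x); last by near: x.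
by near: x.
Unshelve. all: by end_near. Qed.

(** The derivative is again given by power series, hence differentiable and in particular
    continuous. *)
Lemma pseries_smooth_at F (Omega : set C) (z : C) : open Omega ->
  (forall a, Omega a -> pseries_at F a) -> Omega z -> smooth_at F z.
Proof.
move=> oO pF Oz; exists (derive1 F).
  have near_O : \forall w \near z, Omega w by apply: open_nbhs_nbhs.
  near=> w; apply: derivable_derive1; apply: pseries_at_derivable; apply: pF.
  by near: w.
have := pseries_derive oO pF Oz.
move=> /pseries_at_derivable/derivable_derive1 ddF.
exact: is_derive_continuous ddF.
Unshelve. all: by end_near. Qed.

(* Polar Cauchy-Riemann: r Re (F'(z) e^(it)) is the t-derivative of Im F, and Im F
   is written as Re (- i F) to reuse the rule for real parts. *)
Lemma integral_angular_derivative F r : 0 < r ->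
  (forall t, smooth_at F (circle_point r t)) ->
  \int[mu]_(t in `[0, 2 * pi]) Re (derive1 F (circle_point r t) * unit_point t) = 0.
Proof.
move=> r0 sF.
pose G (z : C) := - 'i%C * F z.
pose w t := Re (derive1 F (circle_point r t) * unit_point t).
have cw : continuous w.
  move=> t; apply: cvg_Re; apply: cvgM.
    by apply: (continuous_arc _) => {}t; exact: smooth_at_derive1 (sF t).
  exact: cvg_unit_point.
have dG t : is_derive t 1 (fun t => Re (G (circle_point r t))) (r * w t).
  have -> : r * w t = Re (- 'i%C * derive1 F (circle_point r t) * ('i%C *
    circle_point r t)).
    rewrite [- _ * _ * _](_ : _ = (r%:C)%C * (derive1 F (circle_point r t) *
      unit_point t)).
      by rewrite ReM /= mul0r subr0.
    rewrite circle_pointE mulrACA mulNr -expr2 sqr_i opprK mul1r mulrCA //.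
  apply: is_derive_Re_angle.
  have := is_deriveM (is_derive_cst (- 'i%C : C) (circle_point r t) 1)
    (smooth_at_derivable (sF t)).
  by rewrite scaler0 addr0.
have cG t : {for t, continuous (fun t => Re (G (circle_point r t)))}.
  exact: is_derive_continuous (dG t).
have crw : continuous (fun t => r * w t).
  by move=> t; apply: cvgM; [exact: cvg_cst | exact: cw].
have pi2 : 0 < 2 * pi :> R by rewrite mulr_gt0 ?pi_gt0.
have H : \int[mu]_(t in `[0, 2 * pi]) (r * w t) = 0.
  rewrite /Rintegral (@continuous_FTC2 R (fun t => r * w t) (fun t => Re (G
    (circle_point r t)))) //.
  (* The primitive takes equal values at the two ends of the full period. *)
  - by rewrite circle_point_2pi -EFinB subrr.
  - exact: continuous_subspaceT.
  - split.
    + by move=> t _; case: (dG t).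
    + by apply: cvg_at_right_filter; exact: cG.
    + by apply: cvg_at_left_filter; exact: cG.
  - by move=> t _; exact: is_derive_derive1.
move: H; rewrite RintegralZl //; last exact: continuous_integrable.
by move/eqP; rewrite mulf_eq0 gt_eqF //= => /eqP.
Qed.

(** Differentiation under the integral sign, dominated by a constant that bounds the radial
    derivative for radii near [r]. The resulting integral vanishes by
    [integral_angular_derivative]. *)
Lemma is_derive_integral_Re F u v r : 0 <= u -> r \in `]u, v[ ->
  (forall s t, s \in `]u, v[ -> smooth_at F (circle_point s t)) ->
  is_derive r 1 (fun s => \int[mu]_(t in `[0, 2 * pi]) Re (F (circle_point s t))) 0.
Proof.
move=> u0 ruv sF.
have r0 : 0 < r by move: ruv; rewrite in_itv /= => /andP[ur _]; exact: le_lt_trans ur.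
pose w s t := Re (derive1 F (circle_point s t) * unit_point t).
have [M HM] : exists M, \forall s \near r, forall t, t \in `[0, 2 * pi] -> `|w s t|
  <= M.
  apply: bounded_near_arc => t; apply: cvg_Re; apply: cvgM.
    by apply: continuous_circle_joint; exact: smooth_at_derive1 (sF r t ruv).
  by apply: cvg_unit_point; exact: cvg_snd.
have /nbhs_normP[e /= e0 He] : \forall s \near r, (s \in `]u, v[) /\ forall t, t \in
  `[0, 2 * pi] -> `|w s t| <= M.
  near=> s; split; last by near: s; exact: HM.
  by near: s; exact: near_in_itvoo.
have inI s : s \in `](r - e), (r + e)[ -> ball_ Num.norm r e s.
  by rewrite in_itv /= => /andP[? ?]; rewrite /ball_ /= distrC ltr_distl; apply/andP;
    split.
have Ir : r \in `](r - e), (r + e)[ by rewrite in_itv /= ltrBlDr ltrDl e0.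
have dRe s t : s \in `](r - e), (r + e)[ -> is_derive s 1 (fun s => Re (F
  (circle_point s t))) (w s t).
  move=> sI; apply: is_derive_Re_radius.
  by have [sJ _] := He s (inI s sI); exact: smooth_at_derivable (sF s t sJ).
pose f s t := Re (F (circle_point s t)).
have intf s : s \in `](r - e), (r + e)[ -> mu.-integrable `[0, 2 * pi] (EFin \o f s).
  move=> sI; apply: continuous_integrable => t; apply: cvg_Re.
  apply: continuous_arc => {}t.
  by have [sJ _] := He s (inI s sI); exact: smooth_at_continuous (sF s t sJ).
have derf s t : s \in `](r - e), (r + e)[ -> `[0, 2 * pi]%classic t -> derivable (f
  ^~ t) s 1.
  by move=> sI _; case: (dRe s t sI).
have intM : mu.-integrable `[0, 2 * pi] (EFin \o cst `|M|).
  by apply: continuous_integrable => t; exact: cvg_cst.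
have ubM s t : s \in `](r - e), (r + e)[ -> `[0, 2 * pi]%classic t ->
    `|partial1of2 f s t| <= cst `|M| t.
  move=> sI tI; rewrite /partial1of2 (is_derive_derive1 (dRe s t sI)).
  have [_ Hs] := He s (inI s sI).
  by rewrite (le_trans (Hs t tI)) // ler_norm.
have mI : measurable (`[0, 2 * pi]%classic : set R) by [].
have D1 := @derivable_under_integral R _ _ mu f _ mI r (r - e) (r + e) Ir intf derf _
  (fun=> normr_ge0 M) intM ubM.
have D2 := @differentiation_under_integral R _ _ mu f _ mI r (r - e) (r + e) Ir intf
  derf _ (fun=> normr_ge0 M) intM ubM.
apply: DeriveDef => //; rewrite -derive1E D2.
rewrite -[RHS](integral_angular_derivative r0 (fun t => sF r t ruv)).
by apply: eq_Rintegral => t _; rewrite /partial1of2 (is_derive_derive1 (dRe r t Ir)).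
Unshelve. all: by end_near. Qed.

(** Only continuity of F is asked, so this also applies at radius 1, where differentiability may
    fail. *)
Lemma continuous_integral_Re F u v r : r \in `]u, v[ ->
  (forall s t, s \in `]u, v[ -> {for circle_point s t, continuous F}) ->
  {for r, continuous (fun s => \int[mu]_(t in `[0, 2 * pi]) Re (F (circle_point s t)))}.
Proof.
move=> ruv cF.
pose w s t := Re (F (circle_point s t)).
have [M HM] : exists M, \forall s \near r, forall t, t \in `[0, 2 * pi] -> `|w s t|
  <= M.
  by apply: bounded_near_arc => t; apply: cvg_Re; apply: continuous_circle_joint;
    exact: cF.
have /nbhs_normP[e /= e0 He] : \forall s \near r, (s \in `]u, v[) /\ forall t, t \in
  `[0, 2 * pi] -> `|w s t| <= M.
  near=> s; split; last by near: s; exact: HM.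
  by near: s; exact: near_in_itvoo.
have inI s : s \in `](r - e), (r + e)[ -> ball_ Num.norm r e s.
  by rewrite in_itv /= => /andP[? ?]; rewrite /ball_ /= distrC ltr_distl; apply/andP;
    split.
have Ir : r \in `](r - e), (r + e)[ by rewrite in_itv /= ltrBlDr ltrDl e0.
have intf s : s \in `](r - e), (r + e)[ -> mu.-integrable `[0, 2 * pi] (EFin \o w s).
  move=> sI; apply: continuous_integrable => t; apply: cvg_Re.
  apply: continuous_arc => {}t.
  by have [sJ _] := He s (inI s sI); exact: cF.
have intM : mu.-integrable `[0, 2 * pi] (EFin \o cst M).
  by apply: continuous_integrable => t; exact: cvg_cst.
have mI : measurable (`[0, 2 * pi]%classic : set R) by [].
have cw : {ae mu, forall t, `[0, 2 * pi]%classic t -> {in `](r - e), (r +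
  e)[%classic, continuous (w ^~ t)}}.
  apply/aeW => t _ s /set_mem /= sI; apply: cvg_Re.
  apply: (@cvg_comp _ _ _ (fun s => circle_point s t) F _ _ _ _ (cF s t _)).
    by apply: (@cvg_circle_point R R (nbhs s) _ id (fun=> t) s t); [exact: cvg_id |
      exact: cvg_cst].
  by have [] := He s (inI s sI).
apply: (@continuity_under_integral R _ _ mu w _ mI (r - e) (r + e) intf cw (cst M)
  intM).
  by move=> s sI; apply/aeW => t tI; have [_] := He s (inI s sI); exact.
by rewrite inE.
Unshelve. all: by end_near. Qed.

End RadialDerivative.

(** * Circle integrals and residues *)

Section CircleIntegral.
Variable R : realType.
Local Notation C := (cplx R).
Local Notation Re := (@complex.Re R).
Local Notation Im := (@complex.Im R).
Local Notation mu := (@lebesgue_measure R).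
Implicit Types (r s t u v : R) (F h : C -> C).

(** Continuity in the angle alone. It depends only on the values on the circle, so a function can be
    exchanged for another one that agrees with it there. *)
Definition continuous_on_circle r h := continuous (fun t => h (circle_point r t)).

Lemma continuous_on_circleW r h :
  (forall t, {for circle_point r t, continuous h}) -> continuous_on_circle r h.
Proof. exact: continuous_arc. Qed.

Lemma int02piE (k : R -> C) : int02pi k =
  ((\int[mu]_(t in `[0, 2 * pi]) Re (k t)) +i* (\int[mu]_(t in `[0, 2 * pi]) Im (k
    t)))%C.
Proof. by []. Qed.

Lemma continuous_Re_comp (k : R -> C) : continuous k -> continuous (fun t => Re (k t)).
Proof. by move=> ck t; apply: cvg_Re; exact: ck. Qed.

Lemma continuous_Im_comp (k : R -> C) : continuous k -> continuous (fun t => Im (k t)).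
Proof. by move=> ck t; apply: cvg_Im; exact: ck. Qed.

Lemma int02piD (k1 k2 : R -> C) : continuous k1 -> continuous k2 ->
  int02pi (fun t => k1 t + k2 t) = int02pi k1 + int02pi k2.
Proof.
move=> c1 c2; rewrite !int02piE; simpc.
congr (_ +i* _)%C.
  under eq_Rintegral do rewrite ReD.
  by rewrite RintegralD //; apply: continuous_integrable; exact: continuous_Re_comp.
under eq_Rintegral do rewrite ImD.
by rewrite RintegralD //; apply: continuous_integrable; exact: continuous_Im_comp.
Qed.

Lemma int02piZ (c : C) (k : R -> C) : continuous k ->
  int02pi (fun t => c * k t) = c * int02pi k.
Proof.
move=> ck; rewrite !int02piE; case: c => a b; simpc.
have cR := continuous_Re_comp ck; have cI := continuous_Im_comp ck.
have iR := continuous_integrable 0 (2 * pi) cR.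
have iI := continuous_integrable 0 (2 * pi) cI.
have cZ (x : R) (l : R -> R) : continuous l -> continuous (fun t => x * l t).
  by move=> cl t; apply: cvgM; [exact: cvg_cst | exact: cl].
congr (_ +i* _)%C.
  under eq_Rintegral do rewrite ReM /= -mulNr.
  rewrite RintegralD //; last 2 first.
  - by apply: continuous_integrable; exact: cZ.
  - by apply: continuous_integrable; exact: cZ.
  by rewrite !RintegralZl // mulNr.
under eq_Rintegral do rewrite ImM /=.
rewrite RintegralD //; last 2 first.
- by apply: continuous_integrable; exact: cZ.
- by apply: continuous_integrable; exact: cZ.
by rewrite !RintegralZl.
Qed.

Lemma int02pi_conj (k : R -> C) : continuous k ->
  int02pi (fun t => (k t)^*) = (int02pi k)^*.
Proof.
move=> ck; rewrite !int02piE.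
have -> (a b : R) : ((a +i* b)%C : C)^* = (a -i* b)%C by [].
congr (_ +i* _)%C.
  by under eq_Rintegral do rewrite Re_conj.
under eq_Rintegral do rewrite Im_conj -mulN1r.
by rewrite RintegralZl ?mulN1r //; apply: continuous_integrable; exact:
  continuous_Im_comp.
Qed.

(** The real and imaginary parts are bounded separately by 2 pi M; the lost factor 2 is harmless, as
    the bound serves only to show that quantities are arbitrarily small. *)
Lemma norm_int02pi (k : R -> C) (M : R) : continuous k ->
  (forall t, `|k t| <= (M%:C)%C) -> `|int02pi k| <= ((4 * pi * M)%:C)%C.
Proof.
move=> ck kM.
have bound (l : R -> R) : continuous l -> (forall t, `|l t| <= M) ->
    `|\int[mu]_(t in `[0, 2 * pi]) l t| <= 2 * pi * M.
  move=> cl lM.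
  have il := continuous_integrable 0 (2 * pi) cl.
  rewrite (le_trans (le_normr_Rintegral _ il)) //.
  have -> : 2 * pi * M = \int[mu]_(t in `[0, 2 * pi]) (cst M t).
    rewrite Rintegral_cst // /= lebesgue_measure_itv /= lte_fin mulr_gt0 ?pi_gt0 //.
    by rewrite -EFinB /= subr0 mulrC.
  apply: le_Rintegral => //.
    by apply: continuous_integrable => t; apply: (@cvg_norm _ _ _ _ _ l); exact: cl.
  by apply: continuous_integrable => t; exact: cvg_cst.
rewrite (le_trans (norm_le_Re_Im _)) // lecR int02piE /=.
have -> : 4 * pi * M = 2 * pi * M + 2 * pi * M by ring.
apply: lerD; apply: bound.
- exact: continuous_Re_comp.
- by move=> t; rewrite -lecR (le_trans (norm_Re_le _)).
- exact: continuous_Im_comp.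
- by move=> t; rewrite -lecR (le_trans (norm_Im_le _)).
Qed.

(** Since dz = i z dt, the measure dz / (2 pi i z) is dt / (2 pi); cancelling z requires r > 0. *)
Lemma circle_intE r h : 0 < r -> continuous_on_circle r h ->
  circle_int r h = (2 * (pi%:C)%C)^-1 * int02pi (fun t => h (circle_point r t)).
Proof.
move=> r0 ch; rewrite -int02piZ // /circle_int /contour_int.
congr int02pi; apply/funext => t.
have z0 := circle_point_neq0 t r0.
have pi0 : (pi%:C)%C != 0 :> C by rewrite gt_eqF // ltcR pi_gt0.
move: (circle_point r t) z0 ((pi%:C)%C : C) pi0 => z z0 c c0.
by field; rewrite z0 neq0Ci c0.
Qed.

Lemma eq_circle_int r h1 h2 :
  (forall t, h1 (circle_point r t) = h2 (circle_point r t)) ->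
  circle_int r h1 = circle_int r h2.
Proof.
by move=> H; congr int02pi; apply/funext => t; rewrite H.
Qed.

Lemma continuous_on_circleD r h1 h2 :
  continuous_on_circle r h1 -> continuous_on_circle r h2 ->
  continuous_on_circle r (fun z => h1 z + h2 z).
Proof.
move=> c1 c2 t.
pose k1 t := h1 (circle_point r t); pose k2 t := h2 (circle_point r t).
have ck1 : {for t, continuous k1} by exact: c1.
have ck2 : {for t, continuous k2} by exact: c2.
exact: (continuousD ck1 ck2).
Qed.

Lemma continuous_on_circleM r h1 h2 :
  continuous_on_circle r h1 -> continuous_on_circle r h2 ->
  continuous_on_circle r (fun z => h1 z * h2 z).
Proof.
move=> c1 c2 t.
pose k1 t := h1 (circle_point r t); pose k2 t := h2 (circle_point r t).
have ck1 : {for t, continuous k1} by exact: c1.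
have ck2 : {for t, continuous k2} by exact: c2.
exact: (continuousM ck1 ck2).
Qed.

Lemma continuous_on_circle_cst r (c : C) : continuous_on_circle r (fun=> c).
Proof. by move=> t; apply: cst_continuous. Qed.

Lemma circle_intD r h1 h2 : 0 < r ->
  continuous_on_circle r h1 -> continuous_on_circle r h2 ->
  circle_int r (fun z => h1 z + h2 z) = circle_int r h1 + circle_int r h2.
Proof.
move=> r0 c1 c2.
rewrite (circle_intE r0 (continuous_on_circleD c1 c2)) (circle_intE r0 c1)
  (circle_intE r0 c2).
by rewrite (int02piD c1 c2) mulrDr.
Qed.

Lemma circle_intZ r (c : C) h : 0 < r -> continuous_on_circle r h ->
  circle_int r (fun z => c * h z) = c * circle_int r h.
Proof.
move=> r0 ch.
rewrite (circle_intE r0 ch) (circle_intE r0 (continuous_on_circleM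
  (@continuous_on_circle_cst r c) ch)).
by rewrite (int02piZ c ch) mulrCA.
Qed.

Lemma continuous_on_circle_conj r h : continuous_on_circle r h ->
  continuous_on_circle r (fun z => (h z)^*).
Proof.
move=> ch.
move=> t.
have cR : Re (h (circle_point r s)) @[s --> t] --> Re (h (circle_point r t)).
  by apply: cvg_Re; exact: ch.
have cI : Im (h (circle_point r s)) @[s --> t] --> Im (h (circle_point r t)).
  by apply: cvg_Im; exact: ch.
pose k s : C := (Re (h (circle_point r s)) +i* (- Im (h (circle_point r s))))%C.
have H : k s @[s --> t] --> k t := cvg_complex cR (cvgN cI).
have E : k = (fun s => (h (circle_point r s))^*) by apply/funext => s; rewrite /k;
  case: (h _).
by rewrite E in H; exact: H.
Qed.

Lemma circle_int_conj r h : 0 < r -> continuous_on_circle r h ->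
  circle_int r (fun z => (h z)^*) = (circle_int r h)^*.
Proof.
move=> r0 ch.
have cc := continuous_on_circle_conj ch.
rewrite (circle_intE r0 ch) (circle_intE r0 cc) (int02pi_conj ch) rmorphM fmorphV
  rmorphM /= conjC_nat.
congr ((_ * _)^-1 * _).
by apply/eqP; rewrite eq_complex /= oppr0 !eqxx.
Qed.

(** Continuity and value are proved together because additivity in the inductive step needs the
    continuity of the remaining sum. *)
Lemma circle_int_lincomb r (T : Type) (s : seq T) (c : T -> C) (h : T -> C -> C) : 0
  < r ->
  (forall i, continuous_on_circle r (h i)) ->
  continuous_on_circle r (fun z => \sum_(i <- s) c i * h i z) /\
  circle_int r (fun z => \sum_(i <- s) c i * h i z) = \sum_(i <- s) c i * circle_int
    r (h i).
Proof.
move=> r0 ch; elim: s => [|i s [IHc IHs]].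
  have e0 : (fun z => \sum_(i <- [::]) c i * h i z) = (fun=> 0) by apply/funext => z;
    rewrite big_nil.
  rewrite e0 big_nil; split; first exact: continuous_on_circle_cst.
  have := circle_intZ 0 r0 (@continuous_on_circle_cst r 0).
  by rewrite [RHS]mul0r => H; rewrite -[RHS]H; congr circle_int; apply/funext => z;
    rewrite mul0r.
have es : (fun z => \sum_(j <- i :: s) c j * h j z) = (fun z => c i * h i z + \sum_(j
  <- s) c j * h j z).
  by apply/funext => z; rewrite big_cons.
have ci : continuous_on_circle r (fun z => c i * h i z).
  exact: continuous_on_circleM (@continuous_on_circle_cst r (c i)) (ch i).
rewrite es big_cons; split; first exact: continuous_on_circleD ci IHc.
by rewrite (circle_intD r0 ci IHc) IHs (circle_intZ (c i) r0 (ch i)).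
Qed.

Lemma circle_int_sum r (T : Type) (s : seq T) (c : T -> C) (h : T -> C -> C) : 0 < r ->
  (forall i, continuous_on_circle r (h i)) ->
  circle_int r (fun z => \sum_(i <- s) c i * h i z) = \sum_(i <- s) c i * circle_int
    r (h i).
Proof. by move=> r0 ch; have [] := circle_int_lincomb s c r0 ch. Qed.

Lemma norm_circle_int r h (M : R) : 0 < r -> continuous_on_circle r h ->
  (forall t, `|h (circle_point r t)| <= (M%:C)%C) ->
  `|circle_int r h| <= ((2 * M)%:C)%C.
Proof.
move=> r0 ch hM; rewrite (circle_intE r0 ch) normrM normfV.
have pi0 : 0 < (pi%:C)%C :> C by rewrite ltcR pi_gt0.
have p2 : 0 < 2 * (pi%:C)%C :> C by rewrite mulr_gt0.
rewrite (gtr0_norm p2) [leLHS]mulrC (ler_pdivrMr _ _ p2).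
rewrite (le_trans (norm_int02pi ch hM)) //.
have -> : (2 : C) = ((2 : R)%:C)%C by rewrite -(rmorph_nat (real_complex R)).
rewrite -!rmorphM /= lecR.
by have -> : 4 * pi * M = 2 * M * (2 * pi) by ring.
Qed.

(* Mere continuity is required at radius 1: that is where the removable
   singularities of the residue computation lie. *)
Lemma circle_int_radius_indep F u v r1 r2 : 0 <= u ->
  (forall s t, s \in `]u, v[ -> {for circle_point s t, continuous F}) ->
  (forall s t, s \in `]u, v[ -> s != 1 -> smooth_at F (circle_point s t)) ->
  r1 \in `]u, v[ -> r2 \in `]u, v[ ->
  circle_int r1 F = circle_int r2 F.
Proof.
move=> u0 cF sF r1I r2I.
wlog le12 : r1 r2 r1I r2I / r1 <= r2.
  by move=> H; case/orP: (le_total r1 r2) => ?; [exact: H | symmetry; exact: H].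
have constRe G : (forall s t, s \in `]u, v[ -> {for circle_point s t, continuous G}) ->
    (forall s t, s \in `]u, v[ -> s != 1 -> smooth_at G (circle_point s t)) ->
    forall a b, a \in `]u, v[ -> b \in `]u, v[ -> a <= b ->
    \int[mu]_(t in `[0, 2 * pi]) Re (G (circle_point a t)) =
    \int[mu]_(t in `[0, 2 * pi]) Re (G (circle_point b t)).
  move=> cG sG.
  pose I s := \int[mu]_(t in `[0, 2 * pi]) Re (G (circle_point s t)).
  (* On an interval of radii that does not have 1 in its interior the derivative is zero inside, and
     continuity covers the end points, one of which may be 1. *)
  have flat a b : a \in `]u, v[ -> b \in `]u, v[ -> a <= b -> (b <= 1) || (1 <= a) ->
    I a = I b.
    rewrite !in_itv /= => /andP[ua av] /andP[ub bv] ab ab1.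
    have dI x : x \in `]a, b[ -> is_derive x 1 I 0.
      rewrite in_itv /= => /andP[ax xb].
      have [u' [v' [u'0 xI subI]]] : exists u' v', [/\ 0 <= u', x \in `]u', v'[ &
          forall s, s \in `]u', v'[ -> (s \in `]u, v[) /\ (s != 1)].
        exists a, b; split; first by rewrite (le_trans u0) // ltW.
          by rewrite in_itv /= ax xb.
        move=> s; rewrite !in_itv /= => /andP[as_ sb].
        rewrite (lt_trans ua as_) (lt_trans sb bv); split => //.
        by case/orP: ab1 => H; [rewrite lt_eqF // (lt_le_trans sb H) | rewrite gt_eqF
          // (le_lt_trans H as_)].
      by apply: (is_derive_integral_Re u'0 xI) => s t /subI[sI s1]; exact: sG.
    have cI : {within `[a, b], continuous I}.
      apply: continuous_in_subspaceT => x /set_mem /=; rewrite in_itv /= => /andP[ax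
        xb].
      apply: (@continuous_integral_Re R G u v) => //.
      by rewrite in_itv /= (lt_le_trans ua ax) (le_lt_trans xb bv).
    have [c _] := MVT_segment ab dI cI.
    by rewrite mul0r => /eqP; rewrite subr_eq0 => /eqP.
  move=> a b aI bI ab; rewrite -/(I a) -/(I b).
  (* If a < 1 < b, both sides are compared with the integral at radius 1. *)
  have [b1|b1] := leP b 1; first by apply: flat => //; rewrite b1.
  have [a1|a1] := leP 1 a; first by apply: flat => //; rewrite a1 orbT.
  have I1 : 1 \in `]u, v[.
    move: aI bI; rewrite !in_itv /= => /andP[ua _] /andP[_ bv].
    by rewrite (lt_trans ua a1) (lt_trans b1 bv).
  by rewrite (flat a 1) ?(flat 1 b) ?lexx ?orbT // ltW.
have gt0 r : r \in `]u, v[ -> 0 < r by rewrite in_itv /= => /andP[ur _]; exact: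
  le_lt_trans ur.
have ciF r : r \in `]u, v[ -> continuous_on_circle r F.
  by move=> rI; apply: continuous_on_circleW => t; exact: cF.
rewrite (circle_intE (gt0 _ r1I) (ciF _ r1I)) (circle_intE (gt0 _ r2I) (ciF _ r2I)).
congr (_ * _); rewrite !int02piE; congr (_ +i* _)%C; first exact: (constRe F cF sF r1
  r2 r1I r2I le12).
(* The imaginary part of F is the real part of - i F, to which the same argument applies. *)
pose G (z : C) := - 'i%C * F z.
have ImE z : Im (F z) = Re (G z) by rewrite /G ReM /= oppr0 mul0r sub0r mulNr mul1r
  opprK.
under eq_Rintegral do rewrite ImE; under [RHS]eq_Rintegral do rewrite ImE.
apply: (constRe G _ _ r1 r2 r1I r2I le12) => s t sI.
  exact: continuousM (@cst_continuous C C (- 'i%C) (circle_point s t)) (cF s t sI).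
by move=> s1; exact: smooth_atM (smooth_at_cst (- 'i%C) (circle_point s t)) (sF s t
  sI s1).
Qed.

End CircleIntegral.

(** * The Cauchy kernel and residues in an annulus *)

Section Residue.
Variable R : realType.
Local Notation C := (cplx R).
Local Notation Re := (@complex.Re R).
Local Notation Im := (@complex.Im R).
Local Notation mu := (@lebesgue_measure R).
Implicit Types (r s t u v : R) (F G h : C -> C) (z w a : C).

Lemma circle_int_cst r (c : C) : 0 < r -> circle_int r (fun=> c) = c.
Proof.
move=> r0; rewrite (circle_intE r0 (@continuous_on_circle_cst R r c)) int02piE.
rewrite !Rintegral_cst //= lebesgue_measure_itv /= lte_fin mulr_gt0 ?pi_gt0 //.
rewrite -EFinB /= subr0.
have pi0 : (pi%:C)%C != 0 :> C by rewrite gt_eqF // ltcR pi_gt0.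
have -> : (complex.Re c * (2 * pi) +i* (complex.Im c * (2 * pi)))%C = 2 * (pi%:C)%C *
  c :> C.
  have -> : 2 * (pi%:C)%C = ((2 * pi)%:C)%C :> C by rewrite rmorphM rmorph_nat.
  by case: c => x y; rewrite /= ; simpc; rewrite ![_ * (2 * pi)]mulrC.
by rewrite mulKf // mulf_neq0 // pnatr_eq0.
Qed.

Lemma norm_le_eps_eq0 z : (forall e : R, 0 < e -> `|z| <= (e%:C)%C) -> z = 0.
Proof.
move=> H; apply/eqP; rewrite -normr_le0; apply/ler_addgt0Pr => e /gt0_realC[d d0 ->].
by rewrite add0r H.
Qed.

(** The factor z cancels the one in dz / (2 pi i z): the circle integral is that of the Cauchy
    kernel 1 / (z - a). *)
Definition cauchy_quot a z : C := z * (z - a)^-1.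

Lemma smooth_at_cauchy_quot a z : z != a -> smooth_at (cauchy_quot a) z.
Proof.
move=> za; pose d w : C := w + - a.
have dz : d z != 0 by rewrite /d subr_eq0.
have sd : smooth_at d z := smooth_atD (smooth_at_id z) (smooth_at_cst (- a) z).
have sV : smooth_at (fun w => (d w)^-1) z := smooth_atV dz sd.
exact: (smooth_atM (smooth_at_id z) sV).
Qed.

Lemma circle_point_neq_unit a s t : `|a| = 1 -> 0 < s -> s != 1 -> circle_point s t
  != a.
Proof.
move=> a1 s0 s1; apply/eqP => e; move: a1; rewrite -e norm_circle_point ?ltW //.
by move/complexI/eqP; rewrite (negPf s1).
Qed.

Lemma cauchy_quot_radius_indep a u v r1 r2 : `|a| = 1 -> 0 <= u ->
  1 \notin `]u, v[ -> r1 \in `]u, v[ -> r2 \in `]u, v[ ->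
  circle_int r1 (cauchy_quot a) = circle_int r2 (cauchy_quot a).
Proof.
move=> a1 u0 n1 r1I r2I.
have sm s t : s \in `]u, v[ -> smooth_at (cauchy_quot a) (circle_point s t).
  move=> sI; apply: smooth_at_cauchy_quot; apply: circle_point_neq_unit => //.
    by move: sI; rewrite in_itv /= => /andP[us _]; exact: le_lt_trans us.
  by apply: contraNneq n1 => <-.
apply: (circle_int_radius_indep u0 _ _ r1I r2I) => s t sI.
  exact: smooth_at_continuous (sm s t sI).
by move=> _; exact: sm.
Qed.

Lemma continuous_on_cauchy_quot a r : `|a| = 1 -> 0 < r -> r != 1 ->
  continuous_on_circle r (cauchy_quot a).
Proof.
move=> a1 r0 r1; apply: continuous_on_circleW => t.
by apply: smooth_at_continuous; apply: smooth_at_cauchy_quot; exact: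
  circle_point_neq_unit.
Qed.

(* The integral does not depend on the radius: let it tend to 0. *)
Lemma cauchy_quot_inside a r : `|a| = 1 -> 0 < r -> r < 1 ->
  circle_int r (cauchy_quot a) = 0.
Proof.
move=> a1 r0 r1; apply: norm_le_eps_eq0 => e e0.
(* The second argument is the solution of s = (e / 2) (1 - s), so that |z / (z - a)|, at most s / (1
   - s), is at most e / 2. *)
pose s := (Num.min r ((e / 2) / (1 + e / 2)) : R).
have e2 : 0 < e / 2 by rewrite divr_gt0.
have e21 : 0 < 1 + e / 2 by rewrite addr_gt0.
have s0 : 0 < s by rewrite lt_min r0 divr_gt0.
have sr : s <= r by rewrite ge_min lexx.
have s1 : s < 1 by exact: le_lt_trans r1.
have se : s <= (e / 2) * (1 - s).
  have : s <= (e / 2) / (1 + e / 2) by rewrite ge_min lexx orbT.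
  by rewrite ler_pdivlMr // => H; rewrite mulrBr mulr1 lerBrDr [_ * s]mulrC; rewrite
    mulrDr mulr1 in H.
rewrite (@cauchy_quot_radius_indep a 0 1 r s) ?in_itv //= ?ltxx ?andbF ?r0 ?s0 //.
have -> : e = 2 * (e / 2) by field.
apply: norm_circle_int => //; first by apply: continuous_on_cauchy_quot => //;
  rewrite lt_eqF.
move=> t; rewrite /cauchy_quot normrM normfV (norm_circle_point t (ltW s0)).
have lb : ((1 - s)%:C)%C <= `|circle_point s t - a|.
  have -> : ((1 - s)%:C)%C = `|a| - `|circle_point s t| :> C.
    by rewrite a1 (norm_circle_point t (ltW s0)) rmorphB rmorph1.
  by rewrite distrC lerB_dist.
have lb0 : 0 < ((1 - s)%:C)%C :> C by rewrite ltcR subr_gt0.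
rewrite ler_pdivrMr ?(lt_le_trans lb0) //.
apply: (@le_trans _ _ ((e / 2 * (1 - s))%:C)%C); first by rewrite lecR.
by rewrite rmorphM /= ler_wpM2l // ler0c ltW.
Qed.

(* Here the radius tends to infinity. *)
Lemma cauchy_quot_outside a r : `|a| = 1 -> 1 < r ->
  circle_int r (cauchy_quot a) = 1.
Proof.
move=> a1 r1; have r0 : 0 < r by exact: lt_trans r1.
apply/eqP; rewrite -subr_eq0; apply/eqP; apply: norm_le_eps_eq0 => e e0.
have e2 : 0 < e / 2 by rewrite divr_gt0.
(* After subtracting 1 the integrand is a / (z - a), of modulus at most 1 / (s - 1) = e / 2. *)
pose s := 1 + 2 / e.
have s1 : 1 < s by rewrite /s ltrDl divr_gt0.
have s0 : 0 < s by exact: lt_trans s1.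
have sn1 : s != 1 by rewrite gt_eqF.
have n1 : 1 \notin `]1, (r + s)[ by rewrite in_itv /= ltxx.
have rI : r \in `]1, (r + s)[ by rewrite in_itv /= r1 ltrDl.
have sI : s \in `]1, (r + s)[ by rewrite in_itv /= s1 ltrDr.
rewrite (cauchy_quot_radius_indep a1 ler01 n1 rI sI).
have cq := continuous_on_cauchy_quot a1 s0 sn1.
have -> : 1 = circle_int s (fun=> 1) :> C by rewrite circle_int_cst.
rewrite -mulN1r -(circle_intZ _ s0 (@continuous_on_circle_cst R s 1)).
have c1 := continuous_on_circleM (@continuous_on_circle_cst R s (-1))
  (@continuous_on_circle_cst R s 1).
rewrite -(circle_intD s0 cq c1).
have -> : e = 2 * (e / 2) by field.
apply: (norm_circle_int s0 (continuous_on_circleD cq c1)) => t.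
have za : circle_point s t - a != 0 by rewrite subr_eq0 circle_point_neq_unit.
rewrite (_ : _ + _ = a / (circle_point s t - a)); last by rewrite /cauchy_quot; field.
rewrite normrM normfV a1 mul1r.
have lb : ((s - 1)%:C)%C <= `|circle_point s t - a|.
  have -> : ((s - 1)%:C)%C = `|circle_point s t| - `|a| :> C.
    by rewrite a1 (norm_circle_point t (ltW s0)) rmorphB rmorph1.
  exact: lerB_dist.
have lb0 : 0 < ((s - 1)%:C)%C :> C by rewrite ltcR subr_gt0.
rewrite -[leRHS]invrK lef_pV2 ?posrE ?normr_gt0 ?invr_gt0 ?ltcR //.
apply: le_trans lb; rewrite -fmorphV lecR /s addrAC subrr add0r invf_div; exact: lexx.
Qed.

Lemma near_notin_seq (D : seq C) z : \forall w \near z^', w \notin D.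
Proof.
elim: D => [|a D IHD]; first by near=> w.
have na : \forall w \near z^', w != a.
  have [<-|za] := eqVneq z a; first exact: nbhs_dnbhs_neq.
  apply/nbhs_normP; exists `|z - a|; first by rewrite /= normr_gt0 subr_eq0.
  by move=> w /= zw _; apply: contraTneq zw => ->; rewrite ltxx.
near=> w; rewrite inE negb_or; apply/andP; split; near: w; [exact: na | exact: IHD].
Unshelve. all: by end_near. Qed.

(** Subtracting the principal parts leaves only removable singularities, so the remainder has the
    same integral over both circles. Each principal part contributes 0 to the inner integral and
    [b a] to the outer one. *)
Lemma residue_annulus (D : seq C) G (b : C -> C) u v r1 r2 :
  uniq D -> (forall a, a \in D -> `|a| = 1) -> 0 <= u ->
  (forall s t, s \in `]u, v[ -> circle_point s t \notin D -> smooth_at G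
    (circle_point s t)) ->
  (forall a, a \in D -> exists l : C, G z - b a * cauchy_quot a z @[z --> a^'] --> l) ->
  r1 \in `]u, v[ -> r2 \in `]u, v[ -> r1 < 1 -> 1 < r2 ->
  circle_int r2 G - circle_int r1 G = \sum_(a <- D) b a.
Proof.
move=> uD D1 u0 sG polG r1I r2I r11 r21.
have gt0 r : r \in `]u, v[ -> 0 < r by rewrite in_itv /= => /andP[ur _]; exact:
  le_lt_trans ur.
pose P z := \sum_(a <- D) b a * cauchy_quot a z.
pose G2 z := G z - P z.
(* The values at the points of [D] are filled in by limits. *)
pose G3 z : C := if z \in D then lim (G2 w @[w --> z^']) else G2 z.
have sP z (E : seq C) : (forall a, a \in E -> z != a) -> smooth_at (fun w => \sum_(a
  <- E) b a * cauchy_quot a w) z.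
  move=> zE; apply: smooth_at_sum => a aE.
  exact: smooth_atM (smooth_at_cst (b a) z) (smooth_at_cauchy_quot (zE a aE)).
have sG2 s t : s \in `]u, v[ -> circle_point s t \notin D -> smooth_at G2
  (circle_point s t).
  move=> sI nD; set z := circle_point s t.
  have sPz : smooth_at P z by apply: sP => a aD; apply: contraNneq nD; rewrite /z => ->.
  have := smooth_atD (sG s t sI nD) (smooth_atM (smooth_at_cst (-1) z) sPz).
  by congr smooth_at; apply/funext => w; rewrite mulN1r.
have G2G3 z : z \notin D -> \forall w \near z, G2 w = G3 w.
  move=> zD; have /nbhs_normP[e e0 He] := near_notin_seq D z.
  apply/nbhs_normP; exists e => // w /= we; rewrite /G3.
  have [->|wz] := eqVneq w z; first by rewrite (negPf zD).
  by rewrite (negPf (He w we wz)).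
have sG3 s t : s \in `]u, v[ -> circle_point s t \notin D -> smooth_at G3
  (circle_point s t).
  by move=> sI nD; exact: smooth_at_near_eq (G2G3 _ nD) (sG2 s t sI nD).
have nD s t : s \in `]u, v[ -> s != 1 -> circle_point s t \notin D.
  move=> sI s1; apply/negP => zD.
  by have := circle_point_neq_unit t (D1 _ zD) (gt0 s sI) s1; rewrite eqxx.
have cG3 z : z \in D -> {for z, continuous G3}.
  move=> zD; have [l Hl] := polG z zD.
  (* All principal parts but the one at z are smooth at z; the one at z is controlled by the
     hypothesis on limits. *)
  pose P' w := \sum_(a <- rem z D) b a * cauchy_quot a w.
  have cP' : {for z, continuous P'}.
    apply: smooth_at_continuous; apply: sP => a; rewrite (rem_filter _ uD) mem_filter
      /=.
    by rewrite eq_sym => /andP[].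
  have cP'' : P' w @[w --> z^'] --> P' z.
    exact: cvg_within_filter cP'.
  have G2lim : G2 w @[w --> z^'] --> l - P' z.
    have -> : G2 = (fun w => (G w - b z * cauchy_quot z w) - P' w).
      apply/funext => w; rewrite /G2 /P (perm_big _ (perm_to_rem zD)) big_cons -/(P' w).
      by rewrite opprD addrA.
    exact: cvgB Hl cP''.
  have e3 : G3 z = l - P' z.
    by rewrite /G3 zD; exact: cvg_lim G2lim.
  apply/continuous_withinNx; rewrite e3.
  have E : {near z^', G2 =1 G3}.
    near=> w; rewrite /G3 ifF //; apply/negbTE.
    by near: w; exact: near_notin_seq.
  exact: cvg_trans (near_eq_cvg E) G2lim.
have H3 : circle_int r1 G3 = circle_int r2 G3.
  apply: (circle_int_radius_indep u0 _ _ r1I r2I) => s t sI.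
    have [zD|zD] := boolP (circle_point s t \in D); first exact: cG3.
    exact: smooth_at_continuous (sG3 s t sI zD).
  by move=> s1; exact: sG3 (nD s t sI s1).
have split_int r : r \in `]u, v[ -> r != 1 ->
    circle_int r G3 = circle_int r G - \sum_(a <- D) b a * circle_int r (cauchy_quot a).
  move=> rI r_neq1; have r0 := gt0 r rI.
  rewrite (@eq_circle_int _ r G3 (fun z => G z + \sum_(a <- D) (- b a) * cauchy_quot
    a z)); last first.
    by move=> t; rewrite /G3 (negPf (nD r t rI r_neq1)) /G2 /P -sumrN; congr (_ + _);
      apply: eq_bigr => a _; rewrite mulNr.
  (* [circle_int_lincomb] asks for continuity at every index of the type, so the summands are set to
     0 outside [D]. *)
  pose q a := if a \in D then cauchy_quot a else (fun=> 0).
  have cq a : continuous_on_circle r (q a).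
    rewrite /q; case: ifP => [/D1 a1|_]; first exact: continuous_on_cauchy_quot.
    exact: continuous_on_circle_cst.
  have eq_q (c : C -> C) : (fun z => \sum_(a <- D) c a * cauchy_quot a z) = (fun z =>
    \sum_(a <- D) c a * q a z).
    by apply/funext => z; apply: eq_big_seq => a aD; rewrite /q aD.
  have [cS iS] := circle_int_lincomb D (fun a => - b a) r0 cq.
  have cGr : continuous_on_circle r G.
    apply: continuous_on_circleW => t.
    exact: smooth_at_continuous (sG r t rI (nD r t rI r_neq1)).
  rewrite (_ : (fun z => G z + _) = (fun z => G z + \sum_(a <- D) - b a * q a z));
    last first.
    by apply/funext => z; rewrite -[RHS]/(G z + (fun z => \sum_(a <- D) - b a * q a
      z) z) -eq_q.
  rewrite (circle_intD r0 cGr cS) iS -sumrN; congr (_ + _).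
  by apply: eq_big_seq => a aD; rewrite /q aD mulNr.
have r1n : r1 != 1 by rewrite lt_eqF.
have r2n : r2 != 1 by rewrite gt_eqF.
move: H3; rewrite (split_int r1 r1I r1n) (split_int r2 r2I r2n).
rewrite [X in _ - X = _]big1_seq ?subr0; last first.
  by move=> a /andP[_ aD]; rewrite cauchy_quot_inside ?mulr0 ?D1 // gt0.
move=> ->; rewrite opprB addrCA subrr addr0; apply: eq_big_seq => a aD.
by rewrite cauchy_quot_outside ?mulr1 ?D1.
Unshelve. all: by end_near. Qed.

End Residue.

(** * The kernel *)

Section CirclePoly.
Variable R : realType.
Local Notation C := (cplx R).
Implicit Types (r s t u v : R) (F G h : C -> C) (z w a : C).

(** Compactness reaches only angles in one period; this extends its conclusions to all real
    angles. *)
Lemma angle_mod_2pi t : exists2 t', t' \in `[0, 2 * pi] &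
  forall s, circle_point s t' = circle_point s t.
Proof.
have T0 : 0 < pi *+ 2 :> R by rewrite pmulrn_lgt0 // pi_gt0.
pose k := Num.floor (t / (pi *+ 2)).
have kR : t / (pi *+ 2) \is Num.real by exact: num_real.
have k1 : k%:~R * (pi *+ 2) <= t by rewrite -ler_pdivlMr // floor_le.
have k2 : t < (k + 1)%:~R * (pi *+ 2) by rewrite -ltr_pdivrMr // floorD1_gt.
exists (t - k%:~R * (pi *+ 2)).
  rewrite in_itv /= subr_ge0 k1 /= mulr_natl lerBlDr -{1}[pi *+ 2]mul1r -mulrDl.
  by rewrite addrC -[1]/(1%:~R) -intrD ltW.
move=> s; rewrite /circle_point.
case: (k) => n.
  have e : t = (t - (Posz n)%:~R * (pi *+ 2)) + (pi *+ 2) *+ n.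
    by rewrite -[_ *+ n]mulr_natl subrK.
  by rewrite [in RHS]e (periodicn (@cosD2pi R)) (periodicn (@sinD2pi R)).
rewrite NegzE mulNr opprK.
have -> : (Posz n.+1)%:~R * (pi *+ 2) = (pi *+ 2) *+ n.+1 :> R by rewrite
  -[RHS]mulr_natl.
by rewrite (periodicn (@cosD2pi R)) (periodicn (@sinD2pi R)).
Qed.

Lemma annulus_in_open (Omega : set C) : open Omega -> circle 1 `<=` Omega ->
  exists2 d : R, 0 < d <= 1 &
    forall s t, s \in `](1 - d), (1 + d)[ -> Omega (circle_point s t).
Proof.
move=> oO cO.
have /nbhs_normP[e /= e0 He] : \forall s \near (1 : R), forall t, t \in `[0, 2 * pi]
  -> Omega (circle_point s t).
  apply: near_circle => t.
  have Oz : Omega (circle_point 1 t) by apply: cO; exact: circle_circle_point.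
  have nO : nbhs (circle_point 1 t) Omega by exact: open_nbhs_nbhs.
  exact: (@cvg_circle_point R (R * R)%type (filter_prod (nbhs t) (nbhs (1 : R))) _
    snd fst 1 t cvg_snd cvg_fst Omega nO).
(* The cap 1 keeps the inner radius 1 - d nonnegative, hence all radii of the open interval
   positive. *)
exists (Num.min e 1); first by rewrite lt_min e0 ltr01 ge_min lexx orbT.
move=> s t sI; have [t' t'I <-] := angle_mod_2pi t.
apply: He => //; move: sI; rewrite in_itv /= => /andP[s1 s2].
have me : Num.min e 1 <= e by rewrite ge_min lexx.
by rewrite distrC ltr_distl (le_lt_trans _ s1) ?(lt_le_trans s2) ?lerD2l ?lerN2.
Qed.

Lemma smooth_at_horner (q : {poly C}) G z : smooth_at G z ->
  smooth_at (fun w => q.[G w]) z.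
Proof.
move=> sG; elim/poly_ind: q => [|q c IHq].
  have := smooth_at_cst (0 : C) z; congr smooth_at.
  by apply/funext => w; rewrite horner0.
have := smooth_atD (smooth_atM IHq sG) (smooth_at_cst c z); congr smooth_at.
by apply/funext => w; rewrite hornerMXaddC.
Qed.

Lemma continuous_on_circle_horner (q : {poly C}) r : continuous_on_circle r (fun w =>
  q.[w]).
Proof.
apply: continuous_on_circleW => t; apply: smooth_at_continuous.
exact: smooth_at_horner (smooth_at_id _).
Qed.

Lemma continuous_on_circle_eq r h1 h2 :
  (forall t, h1 (circle_point r t) = h2 (circle_point r t)) ->
  continuous_on_circle r h1 -> continuous_on_circle r h2.
Proof.
move=> H; rewrite /continuous_on_circle.
by have -> : (fun t => h1 (circle_point r t)) = (fun t => h2 (circle_point r t)) by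
  apply/funext.
Qed.

End CirclePoly.

Section KernelAndInnerProduct.
Variable R : realType.
Local Notation C := (cplx R).
Implicit Types (r s t u v : R) (F G h : C -> C) (z w : C).

Section InnerProduct.
Variable f : C -> C.
Hypothesis cf : continuous_on_circle 1 f.
Hypothesis f_ge0 : forall t, 0 <= f (circle_point 1 t).

Definition circle_ip (a b : {poly C}) : C :=
  circle_int 1 (fun z => (a.[z])^* * b.[z] * f z).

Lemma continuous_on_circle_ip (a b : {poly C}) :
  continuous_on_circle 1 (fun z => (a.[z])^* * b.[z] * f z).
Proof.
have ca := continuous_on_circle_conj (@continuous_on_circle_horner R a 1).
have cb := @continuous_on_circle_horner R b 1.
exact: continuous_on_circleM (continuous_on_circleM ca cb) cf.
Qed.

Lemma circle_ip_linr (a : {poly C}) (c : C) (b1 b2 : {poly C}) :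
  circle_ip a (c *: b1 + b2) = c * circle_ip a b1 + circle_ip a b2.
Proof.
have c1 := @continuous_on_circle_ip a b1; have c2 := @continuous_on_circle_ip a b2.
have c1Z := continuous_on_circleM (@continuous_on_circle_cst R 1 c) c1.
rewrite /circle_ip -(circle_intZ c ltr01 c1) -(circle_intD ltr01 c1Z c2).
by apply: eq_circle_int => t; rewrite hornerD hornerZ; ring.
Qed.

Lemma circle_ip_conj (a b : {poly C}) : circle_ip b a = (circle_ip a b)^*.
Proof.
rewrite /circle_ip -(circle_int_conj ltr01 (@continuous_on_circle_ip a b)).
apply: eq_circle_int => t; rewrite !rmorphM /= conjCK.
by rewrite (CrealP (ger0_real (f_ge0 t))) [a.[_] * _]mulrC.
Qed.

Lemma norm_circle_point1 t : `|circle_point 1 t : C| = 1.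
Proof. by rewrite norm_circle_point ?ler01. Qed.

Lemma conj_circle_point1 t : (circle_point 1 t : C)^* = (circle_point 1 t)^-1.
Proof. by rewrite invC_norm norm_circle_point1 expr1n invr1 mul1r. Qed.

Lemma circle_ip_X (a b : {poly C}) : circle_ip ('X * a) ('X * b) = circle_ip a b.
Proof.
apply: eq_circle_int => t; rewrite !hornerM !hornerX rmorphM /= conj_circle_point1.
have z0 := circle_point_neq0 t (@ltr01 R).
move: (circle_point 1 t) z0 => z z0.
by field.
Qed.

(** On the unit circle the reversal of a takes the value z^n conj(a(z)), and z^n cancels against its
    conjugate in the product. *)
Lemma circle_ip_rev n (a b : {poly C}) : (size a <= n.+1)%N -> (size b <= n.+1)%N ->
  circle_ip (revp n a) (revp n b) = circle_ip b a.
Proof.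
move=> sa sb; apply: eq_circle_int => t.
have z0 := circle_point_neq0 t (@ltr01 R).
rewrite !horner_revp // !horner_conjp -!conj_circle_point1 !conjCK.
rewrite rmorphM rmorphXn /= conjCK conj_circle_point1.
move: (circle_point 1 t) z0 => z z0.
have zn : z ^+ n != 0 by rewrite expf_neq0.
by rewrite exprVn; field.
Qed.

End InnerProduct.

Lemma pstarE (p : nat -> {poly C}) k z : size (p k) = k.+1 -> z != 0 ->
  pstar p k z = (revp k (p k)).[z].
Proof.
move=> sk z0; rewrite horner_revp ?sk // horner_conjp /pstar.
by rewrite fmorphV.
Qed.

Lemma Kconti_sum (p : nat -> {poly C}) f n z w :
  continuous_on_circle 1 f -> (forall t, 0 <= f (circle_point 1 t)) ->
  orthonormal_polys f p -> z != 0 -> w != 0 ->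
  Kconti p n z w = \sum_(k < n) (conjp (p k)).[z^-1] * (p k).[w].
Proof.
move=> cf f0 [sp _ op] z0 w0.
have CD := christoffel_darboux (circle_ip_linr cf) (circle_ip_conj cf f0)
  (circle_ip_X f) (@circle_ip_rev f) sp op n.
have KE x : x != z -> x != 0 -> Kquot p n z x = \sum_(k < n) (conjp (p k)).[z^-1] *
  (p k).[x].
  move=> xz x0; rewrite /Kquot !pstarE //.
  have d0 : 1 - z^-1 * x != 0.
    apply: contra xz; rewrite subr_eq0 => /eqP e.
    by apply/eqP; rewrite -[x](mulKf (invr_neq0 z0)) -e invrK mulr1.
  apply: (mulfI d0); rewrite CD.
  (* These two identities turn the right-hand side of the Christoffel-Darboux formula at 1/z into
     the numerator of the kernel at z. *)
  have rz : (revp n (p n)).[z] = z ^+ n * (conjp (p n)).[z^-1].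
    by rewrite horner_revp ?sp.
  have pz : (p n).[z] = z ^+ n * (conjp (revp n (p n))).[z^-1].
    by rewrite -horner_revp ?size_revp // revpK ?sp.
  rewrite rz pz; have zn : z ^+ n != 0 by rewrite expf_neq0.
  move: (z ^+ n) zn (1 - z^-1 * x) d0 => e e0 d d0.
  by field; rewrite e0 d0.
pose S x := \sum_(k < n) (conjp (p k)).[z^-1] * (p k).[x].
rewrite /Kconti; case: eqVneq => [->|wz]; last exact: KE.
have cS : {for z, continuous S}.
  apply: smooth_at_continuous; apply: smooth_at_sum => k _.
  exact: smooth_atM (smooth_at_cst _ z) (smooth_at_horner (p k) (smooth_at_id z)).
have SK : {near z^', S =1 Kquot p n z}.
  have near0 : \forall x \near z^', x != 0.
    apply: cvg_within; exact: (cvgr_neq0 z (@cvg_id _ (nbhs z)) z0).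
  near=> x; symmetry; apply: KE; near: x; first exact: nbhs_dnbhs_neq.
  exact: near0.
have limS : S x @[x --> z^'] --> S z by exact: cvg_within_filter cS.
exact: cvg_lim (cvg_trans (near_eq_cvg SK) limS).
Unshelve. all: by end_near. Qed.

End KernelAndInnerProduct.

(** * Gram matrices and the main identity *)

Section DiscreteGram.
Variable R : realType.
Local Notation C := (cplx R).
Implicit Types (r s t u v : R) (F G h : C -> C) (z w : C).

Lemma det_discrete_gram n (p : nat -> {poly C}) (f : C -> C) (D : {fset C}) :
  (forall k, size (p k) = k.+1) -> (forall z, z \in D -> `|z| = 1) ->
  \det (\matrix_(k < n, l < n) (#|` D|%:R^-1 *
     \sum_(z <- D) ((p k).[z])^* * (p l).[z] * f z)) =
  (\det (coef_mx n p))^* * \det (coef_mx n p) * discrete_toeplitz n f D.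
Proof.
move=> sp D1; apply: det_change_basis => j k; rewrite mxE.
transitivity (#|` D|%:R^-1 * \sum_(z <- D) \sum_(i < n) \sum_(l < n)
    ((p j)`_i)^* * (p k)`_l * (z ^ (l%:Z - i%:Z) * f z)).
  congr (_ * _); apply: eq_big_seq => z /D1 z1.
  rewrite (@horner_conj_mul _ n) ?sp // mulr_suml; apply: eq_bigr => i _.
  by rewrite mulr_suml; apply: eq_bigr => l _; rewrite mulrA.
rewrite exchange_big mulr_sumr; apply: eq_bigr => i _.
rewrite exchange_big mulr_sumr; apply: eq_bigr => l _.
by rewrite mxE -mulr_sumr mulrCA.
Qed.

Lemma continuous_on_circle_exprz (m : int) r : 0 < r ->
  continuous_on_circle r (fun z => z ^ m).
Proof.
move=> r0; case: m => n.
  have := @continuous_on_circle_horner R 'X^n r.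
  by apply: continuous_on_circle_eq => t; rewrite hornerXn.
apply: continuous_on_circleW => t.
have z0 := circle_point_neq0 t r0.
have sV := smooth_atV z0 (smooth_at_id (circle_point r t)).
have := smooth_at_continuous (smooth_at_horner 'X^(n.+1) sV).
have -> : (fun w => ('X^(n.+1)).[w^-1]) = (fun w => w ^ Negz n) :> (C -> C).
  by apply/funext => w; rewrite hornerXn exprVn.
exact.
Qed.

Lemma det_continuous_gram n (p : nat -> {poly C}) (f : C -> C) :
  continuous_on_circle 1 f -> orthonormal_polys f p ->
  (\det (coef_mx n p))^* * \det (coef_mx n p) * continuous_toeplitz n f = 1.
Proof.
move=> cf [sp _ op]; rewrite -(@det1 _ n); symmetry.
apply: det_change_basis => j k; rewrite mxE -(op j k) .
have ch (q : 'I_n * 'I_n) : continuous_on_circle 1 (fun z => z ^ (q.2%:Z - q.1%:Z) *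
  f z).
  exact: continuous_on_circleM (@continuous_on_circle_exprz _ 1 ltr01) cf.
pose c (q : 'I_n * 'I_n) := ((p j)`_q.1)^* * (p k)`_q.2.
transitivity (circle_int 1 (fun z => \sum_q c q * (z ^ (q.2%:Z - q.1%:Z) * f z))).
  apply: eq_circle_int => t.
  rewrite (@horner_conj_mul _ n) ?sp // ?norm_circle_point1 //.
  rewrite pair_bigA /= mulr_suml; apply: eq_bigr => q _.
  by rewrite mulrA.
rewrite (circle_int_sum _ c ltr01 ch) pair_bigA /=; apply: eq_bigr => q _.
by rewrite mxE.
Qed.

(** * The logarithmic derivative of gamma *)

Section LogDerivative.
Variables (Omega : set C) (D : {fset C}) (gamma : C -> C).
Hypothesis oO : open Omega.
Hypothesis pgamma : forall a, Omega a -> pseries_at gamma a.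
Hypothesis gamma0 : forall z, Omega z -> (gamma z = 0 <-> z \in D).
Hypothesis dgamma0 : forall z, z \in D -> derive1 gamma z != 0.

Lemma smooth_at_logderiv h z : Omega z -> z \notin D -> smooth_at h z ->
  smooth_at (fun w => w * derive1 gamma w / gamma w * h w) z.
Proof.
move=> Oz zD sh.
have gz : gamma z != 0 by apply: contra zD => /eqP/(gamma0 Oz).
have sg := pseries_smooth_at oO pgamma Oz.
have sdg := pseries_smooth_at oO (pseries_derive oO pgamma) Oz.
have sV := smooth_atV gz sg.
exact: smooth_atM (smooth_atM (smooth_atM (smooth_at_id z) sdg) sV) sh.
Qed.

(* With q = gamma / (z - a), the function gamma' / gamma - 1 / (z - a) equals
   (gamma' - q) / ((z - a) q), and gamma', q take the same value at a: its limit
   at a is read off the derivatives of gamma' and q there. *)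
Lemma logderiv_simple_pole h a : Omega a -> a \in D -> smooth_at h a ->
  exists l : C, z * derive1 gamma z / gamma z * h z - h a * cauchy_quot a z
    @[z --> a^'] --> l.
Proof.
move=> Oa aD sh.
have ga : gamma a = 0 by apply/(gamma0 Oa).
pose q z : C := if z == a then derive1 gamma a else gamma z / (z - a).
have qa : q a = derive1 gamma a by rewrite /q eqxx.
have [dq dqa] : exists dq, is_derive a 1 q dq.
  have pq : pseries_at q a := pseries_at_div_zero (pgamma Oa) ga.
  by exists (derive1 q a); exact: derivable_derive1 (pseries_at_derivable pq).
have [d2 dga] : exists d2, is_derive a 1 (derive1 gamma) d2.
  have pd := pseries_derive oO pgamma Oa.
  by exists (derive1 (derive1 gamma) a); exact: derivable_derive1
    (pseries_at_derivable pd).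
have dh := smooth_at_derivable sh.
have Sq := is_derive_cvg_slope dqa.
have Sg := is_derive_cvg_slope dga.
have Sh := is_derive_cvg_slope dh.
have cq : q z @[z --> a^'] --> q a by apply: cvg_within_filter; exact:
  is_derive_continuous dqa.
have ch : h z @[z --> a^'] --> h a by apply: cvg_within_filter; exact:
  is_derive_continuous dh.
have cid : z @[z --> a^'] --> a by apply: cvg_within_filter; exact: cvg_id.
have qa0 : q a != 0 by rewrite qa dgamma0.
have cqV : (q z)^-1 @[z --> a^'] --> (q a)^-1 by exact: (cvgV qa0 cq).
(* The two summands in the bracket add up to (gamma'(z) h(z) - q(z) h(a)) / (z - a), because q(a) =
   gamma'(a); the second one is there because the subtracted pole has coefficient h(a) and not
   h(z). *)
pose E z := z * (q z)^-1 * (((derive1 gamma z - derive1 gamma a) / (z - a) -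
    (q z - q a) / (z - a)) * h z + q z * ((h z - h a) / (z - a))).
have cE : E z @[z --> a^'] --> a * (q a)^-1 * ((d2 - dq) * h a + q a * derive1 h a).
  have c1 : z * (q z)^-1 @[z --> a^'] --> a * (q a)^-1 by exact: (cvgM cid cqV).
  have c2 : (derive1 gamma z - derive1 gamma a) / (z - a) - (q z - q a) / (z - a)
      @[z --> a^'] --> d2 - dq by exact: (cvgB Sg Sq).
  have c3 : ((derive1 gamma z - derive1 gamma a) / (z - a) - (q z - q a) / (z - a)) *
    h z
      @[z --> a^'] --> (d2 - dq) * h a by exact: (cvgM c2 ch).
  have c4 : q z * ((h z - h a) / (z - a)) @[z --> a^'] --> q a * derive1 h a by
    exact: (cvgM cq Sh).
  have c5 : ((derive1 gamma z - derive1 gamma a) / (z - a) - (q z - q a) / (z - a)) *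
    h z
     + q z * ((h z - h a) / (z - a)) @[z --> a^'] --> (d2 - dq) * h a + q a * derive1
       h a.
    by exact: (cvgD c3 c4).
  by exact: (cvgM c1 c5).
exists (a * (q a)^-1 * ((d2 - dq) * h a + q a * derive1 h a)).
have nq : \forall z \near a^', q z != 0 by exact: (cvgr_neq0 _ cq qa0).
have EG : {near a^', E =1 fun z => z * derive1 gamma z / gamma z * h z - h a *
  cauchy_quot a z}.
  near=> z; have qz : q z != 0 by near: z.
  have za : z != a by near: z; exact: nbhs_dnbhs_neq.
  have za0 : z - a != 0 by rewrite subr_eq0.
  have -> : gamma z = q z * (z - a) by rewrite /q (negPf za) divfK.
  rewrite /E /cauchy_quot qa.
  move: (q z) qz (derive1 gamma z) (derive1 gamma a) (h z) (h a) => x x0 y y' k k'.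
  by field; rewrite x0 za0.
exact: cvg_trans (near_eq_cvg EG) cE.
Unshelve. all: by end_near. Qed.

(** The point 0 is excluded in the hypothesis on [h] because the functions to which this is applied
    contain z^-1. *)
Lemma residue_logderiv h u v r1 r2 : circle 1 `<=` Omega ->
  (forall z, z \in D -> circle 1 z) -> 0 <= u ->
  (forall s t, s \in `]u, v[ -> Omega (circle_point s t)) ->
  (forall z, Omega z -> z != 0 -> smooth_at h z) ->
  r1 \in `]u, v[ -> r2 \in `]u, v[ -> r1 < 1 -> 1 < r2 ->
  circle_int r2 (fun z => z * derive1 gamma z / gamma z * h z) -
  circle_int r1 (fun z => z * derive1 gamma z / gamma z * h z) = \sum_(a <- D) h a.
Proof.
move=> cO D1 u0 annO sh r1I r2I r11 r21.
apply: (@residue_annulus R D _ h u v) => //; first exact: fset_uniq.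
- move=> s t sI zD; apply: smooth_at_logderiv => //; first exact: annO.
  apply: sh; first exact: annO.
  apply: circle_point_neq0; move: sI; rewrite in_itv /= => /andP[us _].
  exact: le_lt_trans us.
- move=> a aD; have Oa := cO _ (D1 a aD).
  apply: logderiv_simple_pole => //; apply: sh => //.
  by rewrite -normr_gt0 (D1 a aD) ltcR ltr01.
Qed.

End LogDerivative.
End DiscreteGram.

(** * The entries of the finite matrix *)

Section MatrixEntries.
Variable R : realType.
Local Notation C := (cplx R).
Variables (Omega : set C) (D : {fset C}) (f gamma : C -> C).
Variable p : nat -> {poly C}.
Hypothesis oO : open Omega.
Hypothesis cO : circle 1 `<=` Omega.
Hypothesis D1 : forall z, z \in D -> circle 1 z.
Hypothesis pf : forall a, Omega a -> pseries_at f a.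
Hypothesis pgamma : forall a, Omega a -> pseries_at gamma a.
Hypothesis gamma0 : forall z, Omega z -> (gamma z = 0 <-> z \in D).
Hypothesis dgamma0 : forall z, z \in D -> derive1 gamma z != 0.
Hypothesis op : orthonormal_polys f p.

(** On the unit circle this is conj(p_k) p_l f. Writing the conjugate through 1/z makes it
    holomorphic in the annulus, so its contour can be moved. *)
Let h k l z : C := (conjp (p k)).[z^-1] * (p l).[z] * f z.
Let A k z : C := (conjp (p k)).[z^-1] * (vfun D gamma z * f z).
Let B l z : C := (p l).[z].
Let G k l z : C := z * derive1 gamma z / gamma z * h k l z.
Let N : C := #|` D|%:R.

Lemma smooth_at_gram k l z : Omega z -> z != 0 -> smooth_at (h k l) z.
Proof.
move=> Oz z0.
have sV := smooth_atV z0 (smooth_at_id z).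
have s1 := smooth_at_horner (conjp (p k)) sV.
have s2 := smooth_at_horner (p l) (smooth_at_id z).
exact: smooth_atM (smooth_atM s1 s2) (pseries_smooth_at oO pf Oz).
Qed.

Lemma kernel_inside k l eps t : 0 < eps -> eps < 1 ->
  A k (circle_point (1 - eps) t) * B l (circle_point (1 - eps) t) =
  - N^-1 * G k l (circle_point (1 - eps) t).
Proof.
move=> e0 e1; rewrite /A /B /G /h /vfun.
rewrite norm_circle_point; last by rewrite subr_ge0 ltW.
have -> : ((1 - eps)%:C)%C < (1 : C) by rewrite -(rmorph1 (real_complex R)) ltcR
  ltrBlDr ltrDl.
by rewrite invfM; ring.
Qed.

(** The coefficient of [G] is opposite to that on the inner circle, which turns the sum of both
    integrals into a difference; the extra term is the summand -1 of v. *)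
Lemma kernel_outside k l eps t : 0 < eps ->
  A k (circle_point (1 + eps) t) * B l (circle_point (1 + eps) t) =
  N^-1 * G k l (circle_point (1 + eps) t) + (-1) * h k l (circle_point (1 + eps) t).
Proof.
move=> e0; rewrite /A /B /G /h /vfun.
rewrite norm_circle_point; last by rewrite addr_ge0 // ltW.
have -> : (((1 + eps)%:C)%C < (1 : C)) = false.
  by rewrite -(rmorph1 (real_complex R)) ltcR; apply/negbTE; rewrite -leNgt lerDl ltW.
by rewrite invfM; ring.
Qed.

Section Radius.
Variables (d eps : R).
Hypothesis d01 : 0 < d <= 1.
Hypothesis annO : forall s t, s \in `](1 - d), (1 + d)[ -> Omega (circle_point s t).
Hypothesis eps0d : 0 < eps < d.

Let e0 : 0 < eps. Proof. by case/andP: eps0d. Qed.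
Let d0 : 0 < d. Proof. by case/andP: d01. Qed.
Let u0 : 0 <= 1 - d. Proof. by rewrite subr_ge0; case/andP: d01. Qed.
Let e1 : eps < 1.
Proof. by case/andP: eps0d => _ ed; case/andP: d01 => _; exact: lt_le_trans. Qed.
Let r1I : 1 - eps \in `](1 - d), (1 + d)[.
Proof.
have [ep ed] := andP eps0d.
by rewrite in_itv /=; apply/andP; split; lra.
Qed.
Let r2I : 1 + eps \in `](1 - d), (1 + d)[.
Proof.
have [ep ed] := andP eps0d.
by rewrite in_itv /=; apply/andP; split; lra.
Qed.
Let I1 : 1 \in `](1 - d), (1 + d)[.
Proof. by have dp := d0; rewrite in_itv /=; apply/andP; split; lra. Qed.
Let gt0 s : s \in `](1 - d), (1 + d)[ -> 0 < s.
Proof. by rewrite in_itv /= => /andP[us _]; exact: le_lt_trans us. Qed.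

Let smooth_h k l s t : s \in `](1 - d), (1 + d)[ -> smooth_at (h k l) (circle_point s
  t).
Proof.
by move=> sI; apply: smooth_at_gram; [exact: annO | apply: circle_point_neq0; exact:
  gt0].
Qed.

Let continuous_h k l s : s \in `](1 - d), (1 + d)[ -> continuous_on_circle s (h k l).
Proof. by move=> sI; apply: continuous_on_circleW => t; exact: smooth_at_continuous
  (smooth_h k l t sI). Qed.

Let continuous_G k l s : s \in `](1 - d), (1 + d)[ -> s != 1 -> continuous_on_circle
  s (G k l).
Proof.
move=> sI s1; apply: continuous_on_circleW => t; apply: smooth_at_continuous.
apply: (smooth_at_logderiv oO pgamma gamma0).
- exact: annO.
- apply/negP => /D1 z1; have := circle_point_neq_unit t (z1 : `|_| = 1) (gt0 sI) s1.
  by rewrite eqxx.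
- exact: smooth_h.
Qed.

Let r1n1 : 1 - eps != 1. Proof. by rewrite lt_eqF // ltrBlDr ltrDl. Qed.
Let r2n1 : 1 + eps != 1. Proof. by rewrite gt_eqF // ltrDl. Qed.

Lemma continuous_kernel_inside k l :
  continuous_on_circle (1 - eps) (fun z => A k z * B l z).
Proof.
have c1 := continuous_on_circleM (@continuous_on_circle_cst R (1 - eps) (- N^-1))
  (@continuous_G k l _ r1I r1n1).
by apply: continuous_on_circle_eq c1 => t; rewrite kernel_inside.
Qed.

Lemma continuous_kernel_outside k l :
  continuous_on_circle (1 + eps) (fun z => A k z * B l z).
Proof.
have c1 := continuous_on_circleM (@continuous_on_circle_cst R (1 + eps) (N^-1))
  (@continuous_G k l _ r2I r2n1).
have c2 := continuous_on_circleM (@continuous_on_circle_cst R (1 + eps) (-1))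
  (@continuous_h k l _ r2I).
by apply: continuous_on_circle_eq (continuous_on_circleD c1 c2) => t; rewrite
  kernel_outside.
Qed.

Lemma in_out_int_lincomb n (I : finType) (c : I -> C) (k l : I -> 'I_n) :
  in_out_int eps (fun x => \sum_i c i * (A (k i) x * B (l i) x)) =
  \sum_i c i * in_out_int eps (fun x => A (k i) x * B (l i) x).
Proof.
rewrite /in_out_int.
rewrite (circle_int_sum _ c (gt0 r1I) (fun i => @continuous_kernel_inside (k i) (l i))).
rewrite (circle_int_sum _ c (gt0 r2I) (fun i => @continuous_kernel_outside (k i) (l
  i))).
by rewrite -big_split; apply: eq_bigr => i _; rewrite mulrDr.
Qed.

Lemma in_out_int_ext h1 h2 :
  (forall z, (circle (1 - eps) `|` circle (1 + eps)) z -> h1 z = h2 z) ->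
  in_out_int eps h1 = in_out_int eps h2.
Proof.
move=> H; rewrite /in_out_int; congr (_ + _); apply: eq_circle_int => t; apply: H.
  by left; apply: circle_circle_point; exact: ltW (gt0 r1I).
by right; apply: circle_circle_point; exact: ltW (gt0 r2I).
Qed.

(** The contour can be moved to radius 1, where the integral is the orthonormality relation. *)
Lemma circle_int_gram k l s : s \in `](1 - d), (1 + d)[ ->
  circle_int s (h k l) = (k == l)%:R.
Proof.
move=> sI; have [_ _ /(_ k l) <-] := op.
have cs s' t : s' \in `](1 - d), (1 + d)[ -> {for circle_point s' t, continuous (h k
  l)}.
  by move=> sI'; exact: smooth_at_continuous (smooth_h k l t sI').
have ss s' t : s' \in `](1 - d), (1 + d)[ -> s' != 1 -> smooth_at (h k l)
  (circle_point s' t).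
  by move=> sI' _; exact: smooth_h.
rewrite (circle_int_radius_indep u0 cs ss sI I1).
apply: eq_circle_int => t; rewrite /h horner_conjp.
by rewrite -conj_circle_point1 conjCK.
Qed.

Lemma in_out_int_kernel k l :
  in_out_int eps (fun z => A k z * B l z) =
  N^-1 * (\sum_(z <- D) ((p k).[z])^* * (p l).[z] * f z) - (k == l)%:R.
Proof.
have cG1 := @continuous_G k l _ r1I r1n1.
have cG2 := @continuous_G k l _ r2I r2n1.
have ch2 := @continuous_h k l _ r2I.
rewrite /in_out_int.
rewrite (@eq_circle_int R _ (fun z => A k z * B l z) (fun z => - N^-1 * G k l z) (fun
  t => kernel_inside k l t e0 e1)).
rewrite (@eq_circle_int R _ (fun z => A k z * B l z) (fun z => N^-1 * G k l z + (-1)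
  * h k l z) (fun t => kernel_outside k l t e0)).
rewrite (circle_intZ _ (gt0 r1I) cG1).
have c1 := continuous_on_circleM (@continuous_on_circle_cst R (1 + eps) (N^-1)) cG2.
have c2 := continuous_on_circleM (@continuous_on_circle_cst R (1 + eps) (-1)) ch2.
rewrite (circle_intD (gt0 r2I) c1 c2) (circle_intZ _ (gt0 r2I) cG2) (circle_intZ _
  (gt0 r2I) ch2).
rewrite circle_int_gram // mulN1r addrA mulNr [- _ + _]addrC -mulrBr.
congr (_ * _ - _).
have lt1 : 1 - eps < 1 by rewrite ltrBlDr ltrDl.
have gt1 : 1 < 1 + eps by rewrite ltrDl.
rewrite (residue_logderiv oO pgamma gamma0 dgamma0 cO D1 u0 annO (@smooth_at_gram k
  l) r1I r2I lt1 gt1).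
apply: eq_big_seq => a aD; rewrite /h horner_conjp.
have a1 : `|a| = 1 := D1 aD.
by rewrite -[a^-1]mul1r invC_norm a1 expr1n invr1 !mul1r conjCK.
Qed.

End Radius.
End MatrixEntries.

Theorem theorem1p1 (R : realType) (Omega : set (cplx R)) (D : {fset cplx R})
    (f gamma : cplx R -> cplx R) (p : nat -> {poly cplx R}) :
  open Omega -> circle 1 `<=` Omega ->
  D != fset0 -> (forall z, z \in D -> circle 1 z) ->
  analytic_on Omega f ->
  (exists2 z, Omega z & f z != 0) ->
  (forall z, circle 1 z -> 0 <= f z) ->
  analytic_on Omega gamma ->
  (forall z, Omega z -> (gamma z = 0 <-> z \in D)) ->
  (forall z, z \in D -> derive1 gamma z != 0) ->
  orthonormal_polys f p ->
  exists2 eps0 : R, 0 < eps0 &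
    forall eps : R, 0 < eps < eps0 ->
    forall (n : nat) (g : cplx R -> cplx R),
      (forall z, (circle (1 - eps) `|` circle (1 + eps)) z ->
         g z ^+ 2 = vfun D gamma z * f z) ->
      let K := Kkernel p n g in
      cvgn (series (fredholm_term (in_out_int eps) K)) /\
      discrete_toeplitz n f D =
        continuous_toeplitz n f * fredholm_det (in_out_int eps) K.
Proof.
move=> oO cO D_neq0 D1 af _ f_ge0 agamma gamma0 dgamma0 op.
have pf : forall a, Omega a -> pseries_at f a := af.
have pg : forall a, Omega a -> pseries_at gamma a := agamma.
have [d d01 annO] := annulus_in_open oO cO.
exists d; first by case/andP: d01.
move=> eps eps0d n g Hg K.
have e0 : 0 < eps by case/andP: eps0d.
have e1 : eps < 1 by case/andP: eps0d => _ ed; case/andP: d01 => _; exact: lt_le_trans.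
have [sp _ ortho] := op.
have cf : continuous_on_circle 1 f.
  apply: continuous_on_circleW => t; apply: smooth_at_continuous.
  by apply: (pseries_smooth_at oO pf); apply: cO; exact: circle_circle_point.
have f0 t : 0 <= f (circle_point 1 t) by apply: f_ge0; exact: circle_circle_point.
pose S : set (cplx R) := circle (1 - eps) `|` circle (1 + eps).
have S0 z : S z -> z != 0.
  rewrite -normr_gt0 => -[] -> ; rewrite ltcR ?subr_gt0 //.
  by rewrite addr_gt0.
(* The whole weight v f is put into [A], so that neither [A] nor [B] mentions [g]. *)
pose A (k : 'I_n) z := (conjp (p k)).[z^-1] * (vfun D gamma z * f z).
pose B (l : 'I_n) z := (p l).[z].
have HK x y : S x -> S y -> K x y = (\sum_(l < n) (conjp (p l)).[x^-1] * B l y) * (g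
  x * g y).
  by move=> Sx Sy; rewrite /K /Kkernel (Kconti_sum n cf f0 op (S0 x Sx) (S0 y Sy)).
have HA l x : S x -> A l x = (conjp (p l)).[x^-1] * g x ^+ 2.
  by move=> Sx; rewrite (Hg x Sx).
have ext := in_out_int_ext d01 eps0d.
have lin := in_out_int_lincomb p oO D1 pf pg gamma0 d01 annO eps0d.
have cv := fredholm_finite_rank (ext) (@lin n) HK HA.
set detM := \det _ in cv.
split; first exact: cvgP cv.
have -> : fredholm_det (in_out_int eps) K = detM by exact: cvg_lim cv.
have eM : detM = \det (\matrix_(k < n, l < n) (#|` D|%:R^-1 *
     \sum_(z <- D) ((p k).[z])^* * (p l).[z] * f z)).
  congr (\det _); apply/matrixP => k l; rewrite !mxE.
  rewrite (in_out_int_kernel oO cO D1 pf pg gamma0 dgamma0 op d01 annO eps0d).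
  (* The Kronecker delta subtracted in the entry of M cancels that of the identity matrix. *)
  by rewrite addrC subrK.
rewrite eM det_discrete_gram //.
(* The change of basis factor times the continuous determinant is 1, so no division and no separate
   proof that either is nonzero is needed. *)
by rewrite mulrA [continuous_toeplitz n f * _]mulrC det_continuous_gram // mul1r.
Qed.
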